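(* Let $\mathbb{X}$ and $\mathbb{Y}$ be Asplund spaces, let $f:\mathbb{X}\to\mathbb{Y}$ be a continuously differentiable mapping and let $\{C_1,\dots,C_m\}$ be a collection of finitely many closed convex sets in $\mathbb{Y}$ such that $C:=\bigcap_{i=1}^mC_i$ is nonempty. Let $A_i:=f^{-1}(C_i)$ ($i=1,\dots,m$) and let $\bar x\in A:=\bigcap_{i=1}^mA_i$ be such that the derivative $\nabla f(\bar x)$ is surjective. Then the following statements are equivalent: (i) $\{A_1,\dots,A_m\}$ is subtransversal at $\bar x$; (ii) there exist $\tau,\delta>0$ such that for all $x\in A\cap\mathbf{B}(\bar x,\delta)$, $\{A_1,\dots,A_m\}$ has the strong Fréchet CHIP at $x$ and $\{\hat N(A_1,x),\dots,\hat N(A_m,x)\}$ has property (G) with constant $\tau$; (iii) there exist $\tau,\delta>0$ such that for all $x\in A\cap\mathbf{B}(\bar x,\delta)$, $\{A_1,\dots,A_m\}$ has the strong limiting CHIP at $x$ and $\{N(A_1,x),\dots,N(A_m,x)\}$ has property (G) with constant $\tau$.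
   Context: $\mathbb{X}^*$ is the topological dual of $\mathbb{X}$; $\mathbf{B}_{\mathbb{X}^*}$ is the closed unit ball of $\mathbb{X}^*$; $\mathbf{B}(x,r)$ is the open ball with center $x$ and radius $r$; $\mathbf{d}(x,S)=\inf_{y\in S}\|x-y\|$. A real Banach space is Asplund if every continuous convex function on it is Fréchet differentiable at each point of a dense subset. For a closed set $A\subseteq\mathbb{X}$, $x\in A$ and $\varepsilon\ge0$, let $\hat N_\varepsilon(A,x)=\{x^*\in\mathbb{X}^*:\limsup_{y\to x,\,y\in A}\frac{\langle x^*,y-x\rangle}{\|y-x\|}\le\varepsilon\}$. The Fréchet normal cone is $\hat N(A,x)=\hat N_0(A,x)$. The limiting (Mordukhovich) normal cone $N(A,x)$ is the set of all $x^*\in\mathbb{X}^*$ for which there are sequences $x_n\to x$ with $x_n\in A$, $\varepsilon_n\ge0$ with $\varepsilon_n\to0$, and $x_n^*\to x^*$ weak$^*$ with $x_n^*\in\hat N_{\varepsilon_n}(A,x_n)$ for all $n$. (In Asplund spaces one may equivalently take $\varepsilon_n=0$.) Let $\{A_1,\dots,A_m\}$ be closed sets with nonempty intersection $A$. - It is subtransversal at $\bar x\in A$ if there exist $\tau,r\in(0,+\infty)$ such that $\mathbf{d}(x,A)\le\tau\sum_{i=1}^m\mathbf{d}(x,A_i)$ for all $x\in\mathbf{B}(\bar x,r)$. - It has the strong Fréchet CHIP at $x\in A$ if $\hat N(A,x)\subseteq\sum_{i=1}^m\hat N(A_i,x)$. - It has the strong limiting CHIP at $x\in A$ if $N(A,x)\subseteq\sum_{i=1}^mN(A_i,x)$.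 A finite collection of cones $\{P_1,\dots,P_m\}$ in $\mathbb{X}^*$ has property (G) with constant $\tau\in(0,+\infty)$ if $\big(\sum_{i=1}^mP_i\big)\cap\mathbf{B}_{\mathbb{X}^*}\subseteq\tau\sum_{i=1}^m(P_i\cap\mathbf{B}_{\mathbb{X}^*})$. *)

(* Defs.v *)
From HB Require Import structures.
From mathcomp Require Import all_boot all_order all_algebra.
From mathcomp Require Import all_classical all_reals all_analysis.

Set Implicit Arguments.
Unset Strict Implicit.
Unset Printing Implicit Defensive.

Import Order.TTheory GRing.Theory Num.Theory.
Import numFieldNormedType.Exports.

Local Open Scope classical_set_scope.
Local Open Scope ring_scope.

Section NormedSpaces.
Context {R : realType}.

Definition dist {X : normedModType R} (x : X) (S : set X) : R :=
  inf [set `|x - y| | y in S].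

(* The set on the right is bounded whenever g is linear and continuous. *)
Definition op_norm {U V : normedModType R} (g : U -> V) : R :=
  sup [set `|g h| | h in [set h : U | `|h| <= 1]].

(* Functionals are elements of the function space X -> R^o, whose pointwise
   addition and scaling are those of the dual. *)
Definition dual (X : normedModType R) : set (X -> R^o) :=
  [set xs | linear xs /\ continuous xs].
Arguments dual : clear implicits.

Definition dual_ball (X : normedModType R) : set (X -> R^o) :=
  [set xs | dual X xs /\ op_norm xs <= 1].

Definition weak_star_cvg {X : normedModType R}
    (xs : nat -> X -> R^o) (l : X -> R^o) : Prop :=
  forall h : X, xs n h @[n --> \oo] --> l h.

Definition continuously_differentiable {X Y : normedModType R}
    (f : X -> Y) : Prop :=
  (forall x, differentiable f x) /\
  (forall x, op_norm ('d f y \- 'd f x) @[y --> x] --> (0 : R)).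

Definition asplund (X : completeNormedModType R) : Prop :=
  forall phi : X -> R^o, continuous phi -> convex_function setT phi ->
  exists2 D : set X, dense D & forall x, D x -> differentiable phi x.

End NormedSpaces.
Arguments dual {R} X _.
Arguments dual_ball {R} X _.

Section NormalCones.
Context {R : realType} {X : normedModType R}.
Implicit Types (A : set X) (x : X).

(* If x is isolated in A, the filter is improper and the limsup is -oo. *)
Definition eps_normal (e : R) A x : set (X -> R^o) :=
  [set xs | dual X xs /\
    (limf_esup (fun y : X => (xs (y - x) / `|y - x|)%:E) (within A x^')
       <= e%:E)%E].

Definition frechet_normal A x : set (X -> R^o) := eps_normal 0 A x.

Definition limiting_normal A x : set (X -> R^o) :=
  [set xs | dual X xs /\
    exists (u : nat -> X) (e : nat -> R) (us : nat -> X -> R^o),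
      [/\ forall n, A (u n), u n @[n --> \oo] --> x,
          forall n, 0 <= e n, e n @[n --> \oo] --> (0 : R) &
          weak_star_cvg us xs /\
          forall n, eps_normal (e n) A (u n) (us n)]].

End NormalCones.

Section Collections.
Context {R : realType} {X : normedModType R} {m : nat}.

Definition minkowski_sum (P : 'I_m -> set (X -> R^o)) : set (X -> R^o) :=
  [set s | exists2 p : 'I_m -> (X -> R^o),
     forall i, P i (p i) & s = \sum_(i < m) p i].

Definition property_G (tau : R) (P : 'I_m -> set (X -> R^o)) : Prop :=
  minkowski_sum P `&` dual_ball X `<=`
  [set tau *: s | s in minkowski_sum (fun i => P i `&` dual_ball X)].

Implicit Types (A : 'I_m -> set X) (x : X).

Definition subtransversal A x : Prop :=
  exists tau r : R, [/\ 0 < tau, 0 < r &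
    forall y, ball x r y ->
      dist y (\bigcap_i A i) <= tau * \sum_(i < m) dist y (A i)].

Definition strong_frechet_CHIP A x : Prop :=
  frechet_normal (\bigcap_i A i) x `<=`
  minkowski_sum (fun i => frechet_normal (A i) x).

Definition strong_limiting_CHIP A x : Prop :=
  limiting_normal (\bigcap_i A i) x `<=`
  minkowski_sum (fun i => limiting_normal (A i) x).

End Collections.

(* Main.v *)
Require Import Defs.
From HB Require Import structures.
From mathcomp Require Import all_boot all_order all_algebra.
From mathcomp Require Import all_classical all_reals all_analysis.
From mathcomp Require Import ring lra.

(** Near [xbar] the derivative of [f] is surjective with a uniform openness
    constant, and [f] is metrically regular (Lyusternik-Graves).  Hence the
    Frechet and the limiting normal cones of [f @^-1` S], for [S] convex, both
    coincide at [x] with the normal cone at 0 of the linearized set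
    [{h | f x + f'(x) h \in S}], so that (ii) and (iii) are the same statement
    about these linearized cones; and subtransversality of the preimages at
    [xbar] amounts to subtransversality of the convex sets [C i] at [f xbar].

    From (i) to (ii): a linearized normal [l] of norm at most 1 satisfies
    [l h <= k * dist (f x + f'(x) h, C) <= c * \sum_i dist (f x + f'(x) h, C i)]
    for small [h], thus for all [h] by convexity, and the convex sum rule splits
    [l] along the summands.

    From (ii) to (i): Ekeland's principle and the Hahn-Banach theorem give,
    for [z] near [f xbar], a point [c] of [C] and a normal [l] to [C] at [c] of
    norm at most 2 such that [dist (z, C) <= |z - c| <= 2 * l (z - c)].  Splitting
    [l \o f'(x)], where [f x = c], according to (ii) bounds the right-hand side by
    a multiple of [\sum_i dist (z, C i)]. *)

Set Implicit Arguments.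
Unset Strict Implicit.
Unset Printing Implicit Defensive.

Import Order.TTheory GRing.Theory Num.Theory.
Import numFieldNormedType.Exports.

Local Open Scope classical_set_scope.
Local Open Scope ring_scope.

(** * Linear minorants of convex functions *)

Section LinearPredicate.
Context {R : nzRingType} {U V : lmodType R} (g : U -> V) (ling : linear g).

(** Functionals are bare functions satisfying the predicate [linear]; packing [g] as a bundled
    linear map transfers the generic identities to them. *)
Let G : {linear U -> V} := HB.pack g (GRing.isLinear.Build _ _ _ _ _ ling).

Lemma linear_fun0 : g 0 = 0. Proof. exact: (linear0 G). Qed.

Lemma linear_funN x : g (- x) = - g x. Proof. exact: (linearN G). Qed.

Lemma linear_funD x y : g (x + y) = g x + g y. Proof. exact: (linearD G). Qed.

Lemma linear_funB x y : g (x - y) = g x - g y. Proof. exact: (linearB G). Qed.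

Lemma linear_funZ a x : g (a *: x) = a *: g x. Proof. exact: (linearZ_LR G). Qed.

End LinearPredicate.

Section ConvexMinorant.
Context {R : realType} {V : lmodType R}.
Implicit Types (p q : V -> R) (x y : V).

Definition convexf p := forall x y (t : R), 0 <= t <= 1 ->
  p (t *: x + (1 - t) *: y) <= t * p x + (1 - t) * p y.

(** Midpoint convexity between [x] and [- x]. It bounds all convex minorants of [p] that are
    nonnegative at 0 from below by [- p (- x)], so that chains of them have infima. *)
Lemma convexf_opp_ge p x : convexf p -> 0 <= p 0 -> - p (- x) <= p x.
Proof.
move=> cp p0; have := cp x (- x) 2^-1.
have -> : 2^-1 *: x + (1 - 2^-1) *: - x = 0.
  by rewrite scalerN -scalerBl (_ : _ - _ = 0 :> R) ?scale0r//; field.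
by move=> /(_ ltac:(lra)); lra.
Qed.

Lemma convexf_scale p x (t : R) : convexf p -> p 0 = 0 -> 0 <= t <= 1 ->
  p (t *: x) <= t * p x.
Proof.
by move=> cp p0 t01; have := cp x 0 t t01; rewrite scaler0 addr0 p0 mulr0 addr0.
Qed.

Lemma convexf_shift p y (c : R) : convexf p -> convexf (fun x => p (x + y) - c).
Proof.
move=> cp u v t t01; have := cp (u + y) (v + y) t t01.
rewrite !scalerDr addrACA -scalerDl (_ : t + (1 - t) = 1) ?scale1r; last by ring.
by move=> ?; lra.
Qed.

Lemma convexf_rescale p (s : R) : 0 < s ->
  convexf p -> convexf (fun x => s^-1 * p (s *: x)).
Proof.
move=> s0 cp u v t t01; have := cp (s *: u) (s *: v) t t01.
rewrite !scalerA ![_ * s]mulrC -!scalerA -scalerDr => H.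
rewrite !(mulrCA _ s^-1) -mulrDr ler_pM2l ?invr_gt0//.
Qed.

Let minorant p := {q | [/\ convexf q, 0 <= q 0 & forall x, q x <= p x]}.
(** The order is reversed, so that the maximal elements given by Zorn's lemma are minimal
    functions. *)
Let below p (q r : minorant p) : bool :=
  `[< forall x, sval r x <= sval q x >].

(** Zorn's lemma: the pointwise infimum of a nonempty chain is again a convex minorant, nonnegative
    at 0. *)
Lemma minimal_convexf p : convexf p -> 0 <= p 0 ->
  exists q, [/\ convexf q, 0 <= q 0, forall x, q x <= p x &
    forall r, convexf r -> 0 <= r 0 -> (forall x, r x <= q x) -> r = q].
Proof.
move=> cp p0.
have pM : [/\ convexf p, 0 <= p 0 & forall x, p x <= p x] by [].
have [||A Atot|[q [cq q0 qp]] /= qmin] :=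
  @ZL_preorder (minorant p) (exist _ p pM) (@below p).
- by move=> q; apply/asboolP.
- move=> r q s /asboolP rq /asboolP qs; apply/asboolP => x.
  exact: le_trans (qs x) (rq x).
- have [[a0 Aa0]|A0] := pselect (A !=set0); last first.
    by exists (exist _ p pM) => s As; exfalso; apply: A0; exists s.
  pose vals x := [set sval a x | a in A].
  have lbA x : lbound (vals x) (- p (- x)).
    move=> _ [[a [ca a00 ap]] Aa <-] /=.
    by apply: le_trans (convexf_opp_ge x ca a00); rewrite lerN2.
  have infA x a : A a -> inf (vals x) <= sval a x.
    by move=> Aa; apply: ge_inf; [exists (- p (- x)); exact: lbA|exists a].
  have vals0 x : vals x !=set0 by exists (sval a0 x); exists a0.
  have hasA x : has_inf (vals x).
    by split=> //; exists (- p (- x)); exact: lbA.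
  have rM : [/\ convexf (fun x => inf (vals x)), 0 <= inf (vals 0) &
      forall x, inf (vals x) <= p x].
    split.
    + move=> u v t /andP[t0 t1]; apply/ler_addgt0Pr => e e0.
      have t1' : 0 <= 1 - t by rewrite subr_ge0.
      have [_ [a Aa <-] au] := inf_adherent e0 (hasA u).
      have [_ [b Ab <-] bv] := inf_adherent e0 (hasA v).
      (* Infima of convex functions need not be convex, but in a chain the smaller of [a] and [b] is
         nearly optimal at both points. *)
      have [c Ac [ca cb]] : exists2 c, A c & sval c u <= sval a u /\ sval c v <= sval b v.
        by have [/asboolP ba|/asboolP ab] := Atot _ _ Aa Ab; [exists b|exists a].
      apply: le_trans (infA _ c Ac) _; case: c {Ac} ca cb => c [cc c00 cp'] /= ca cb.
      apply: le_trans (cc u v t _) _; first by rewrite t0.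
      have tu : t * c u <= t * (inf (vals u) + e) by apply: ler_wpM2l => //; lra.
      have tv : (1 - t) * c v <= (1 - t) * (inf (vals v) + e).
        by apply: ler_wpM2l => //; lra.
      lra.
    + apply: lb_le_inf => // _ [[a [ca a00 ap]] Aa <-] //.
    + move=> x; apply: le_trans (infA x a0 Aa0) _.
      by case: a0 {Aa0 infA} => a [? ? ap] /=.
  exists (exist (fun q => [/\ convexf q, 0 <= q 0 & forall x, q x <= p x]) _ rM).
  by move=> s As; apply/asboolP => x /=; exact: infA.
- exists q; split=> // r cr r0 rq; apply/funext => x; apply/eqP.
  have rM : [/\ convexf r, 0 <= r 0 & forall x, r x <= p x].
    by split=> // y; apply: le_trans (rq y) (qp y).
  rewrite eq_le rq /=.
  have /asboolP qr := qmin (exist _ r rM) (introT (asboolP _) rq).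
  exact: qr.
Qed.

(* A minimal [q] is linear, because [s^-1 * q (s *: x)], for [0 < s <= 1], and
   [q (x + y) - q y] are admissible competitors below [q]. *)
Lemma convexf_linear_minorant p : convexf p -> 0 <= p 0 ->
  exists2 l : V -> R^o, linear l & forall x, l x <= p x.
Proof.
move=> cp p0; have [q [cq q0 qp qmin]] := minimal_convexf cp p0.
(* The shift by 0 gives the competitor [q - q 0], which lies below [q] and hence equals it. *)
have q00 : q 0 = 0.
  have : (fun x => q (x + 0) - q 0) = q.
    apply: qmin; [exact: convexf_shift|by rewrite addr0 subrr|].
    by move=> x; rewrite addr0 gerBl.
  by move=> /(congr1 (@^~ 0)) /=; rewrite addr0 subrr.
have qs (s : R) x : 0 < s <= 1 -> q (s *: x) = s * q x.
  move=> /andP[s0 s1].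
  have : (fun x => s^-1 * q (s *: x)) = q.
    apply: qmin; [exact: convexf_rescale|by rewrite scaler0 q00 mulr0|].
    move=> y; rewrite ler_pdivrMl//; apply: convexf_scale => //.
    by rewrite ltW.
  by move=> /(congr1 (@^~ x)) /= <-; rewrite mulVKf ?gt_eqF.
have qS x y : q (x + y) <= q x + q y.
  have := cq x y 2^-1 ltac:(lra).
  rewrite (_ : 1 - 2^-1 = 2^-1); last by field.
  rewrite -scalerDr -mulrDr qs; last by apply/andP; split; lra.
  by rewrite ler_pM2l ?invr_gt0.
have qD x y : q (x + y) = q x + q y.
  have : (fun x => q (x + y) - q y) = q.
    apply: qmin; [exact: convexf_shift|by rewrite add0r subrr|].
    by move=> z; rewrite lerBlDr.
  by move=> /(congr1 (@^~ x)) /= <-; rewrite subrK.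
have qN x : q (- x) = - q x.
  by apply/eqP; rewrite -addr_eq0 -qD addNr q00.
have qp' (s : R) x : 0 < s -> q (s *: x) = s * q x.
  move=> s0; have [s1|s1] := leP s 1; first by apply: qs; rewrite s0.
  have := qs s^-1 (s *: x).
  rewrite scalerA mulVf ?gt_eqF// scale1r => -> //.
    by rewrite mulVKf ?gt_eqF.
  by rewrite invr_gt0 s0/= invf_le1// ltW.
have qZ (s : R) x : q (s *: x) = s * q x.
  have [s0|s0|->] := ltgtP s 0; last by rewrite scale0r mul0r.
  - by rewrite -[s]opprK scaleNr qN qp' ?oppr_gt0// !mulNr !opprK.
  - exact: qp'.
by exists q => // a x y; rewrite qD qZ.
Qed.

End ConvexMinorant.

(** * Partial minimization and the convex sum rule *)

Section ConvexSums.
Context {R : realType} {V : lmodType R}.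

Lemma convex_setP (A : set (convex_lmodType V)) x y (t : R) :
  convex_set A -> A x -> A y -> 0 <= t <= 1 ->
  A ((t *: x : V) + (1 - t) *: y).
Proof.
move=> cA Ax Ay t01; have := cA x y (Itv01 (andP t01).1 (andP t01).2).
by rewrite !inE => /(_ Ax Ay).
Qed.

(** Partial minimization of a jointly convex function: near-minimizers at two points are averaged.
    The minorant [b] keeps the infima finite. *)
Lemma convexf_inf (W : lmodType R) (G : V -> W -> R) (b : V -> R)
    (S : set W) : S !=set0 -> (forall u w, S w -> b u <= G u w) ->
  (forall w1 w2 (t : R), S w1 -> S w2 -> 0 <= t <= 1 ->
    S (t *: w1 + (1 - t) *: w2)) ->
  (forall u1 u2 w1 w2 (t : R), S w1 -> S w2 -> 0 <= t <= 1 ->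
    G (t *: u1 + (1 - t) *: u2) (t *: w1 + (1 - t) *: w2) <=
    t * G u1 w1 + (1 - t) * G u2 w2) ->
  convexf (fun u => inf [set G u w | w in S]).
Proof.
move=> [w0 Sw0] bG cS cG u v t /andP[t0 t1]; apply/ler_addgt0Pr => e e0.
have hasG x : has_inf [set G x w | w in S].
  by split; [exists (G x w0), w0|exists (b x) => _ [w Sw <-]; exact: bG].
have t1' : 0 <= 1 - t by rewrite subr_ge0.
have [_ [a Sa <-] au] := inf_adherent e0 (hasG u).
have [_ [c Sc <-] cv] := inf_adherent e0 (hasG v).
apply: le_trans (_ : G (t *: u + (1 - t) *: v) (t *: a + (1 - t) *: c) <= _).
  apply: ge_inf; first exact: (hasG _).2.
  by exists (t *: a + (1 - t) *: c) => //; apply: cS => //; rewrite t0.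
apply: le_trans (cG _ _ _ _ _ _ _ _) _ => //; first by rewrite t0.
have tu : t * G u a <= t * (inf [set G u w | w in S] + e).
  by apply: ler_wpM2l => //; exact: ltW.
have tv : (1 - t) * G v c <= (1 - t) * (inf [set G v w | w in S] + e).
  by apply: ler_wpM2l => //; exact: ltW.
by lra.
Qed.

Lemma convexf_sum m (p : 'I_m -> V -> R) : (forall i, convexf (p i)) ->
  convexf (fun x => \sum_(i < m) p i x).
Proof.
move=> cp x y t t01; rewrite !mulr_sumr -big_split/=.
by apply: ler_sum => i _; exact: cp.
Qed.

(* The inf-convolution of [p] and [q - l] is convex and nonnegative at 0;
   any linear minorant of it splits [l]. *)
Lemma linear_le_add_split (p q : V -> R) (b : V -> R) (l : V -> R^o) :
  convexf p -> convexf q -> p 0 = 0 -> q 0 = 0 ->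
  (forall u h, p h - b u <= p (u + h)) ->
  linear l -> (forall h, l h <= p h + q h) ->
  exists l1 : V -> R^o,
    [/\ linear l1, forall h, l1 h <= p h & forall h, l h - l1 h <= q h].
Proof.
move=> cp cq p0 q0 bp linl lpq.
pose G u h : R := p (u + h) + q h - l h.
have bG u h : - b u <= G u h.
  by rewrite /G; have := bp u h; have := lpq h; lra.
have Gne u : [set G u h | h in setT] !=set0 by exists (G u 0), 0.
have cG : convexf (fun u => inf [set G u h | h in setT]).
  apply: (@convexf_inf _ G (fun u => - b u)) => //; first by exists 0.
  move=> u1 u2 w1 w2 t _ _ t01; rewrite /G.
  have := cp (u1 + w1) (u2 + w2) t t01; have := cq w1 w2 t t01.
  rewrite !scalerDr [in p _]addrACA linl.
  have -> : l ((1 - t) *: w2) = (1 - t) *: l w2.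
    exact: linear_funZ.
  rewrite /GRing.scale/=; lra.
have G0 : 0 <= inf [set G 0 h | h in setT].
  apply: lb_le_inf => // _ [h _ <-].
  by rewrite /G add0r subr_ge0.
have [l1 linl1 l1G] := convexf_linear_minorant cG G0.
have {}l1G u h : l1 u <= G u h.
  by apply: le_trans (l1G u) _; apply: ge_inf; [exists (- b u) => _ [k _ <-]|exists h].
(* In [l1 u <= G u v], the pair [(h, 0)] gives the bound by [p], and [(- h, h)] the bound by [q]. *)
exists l1; split => // h.
- apply: le_trans (l1G h 0) _.
  by rewrite /G addr0 q0 addr0 (linear_fun0 linl) subr0.
- have := l1G (- h) h; rewrite (linear_funN linl1).
  by rewrite /G addNr p0; lra.
Qed.

(** Induction on [m], splitting off the first summand. The condition with [b i], typical of
    Lipschitz functions, keeps the infimal convolutions finite. *)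
Lemma linear_le_sum_split m (p : 'I_m -> V -> R) (b : 'I_m -> V -> R)
    (l : V -> R^o) :
  (forall i, convexf (p i)) -> (forall i, p i 0 = 0) ->
  (forall i u h, p i h - b i u <= p i (u + h)) ->
  linear l -> (forall h, l h <= \sum_(i < m) p i h) ->
  exists2 ls : 'I_m -> V -> R^o,
    forall i, linear (ls i) /\ forall h, ls i h <= p i h & l = \sum_(i < m) ls i.
Proof.
elim: m p b l => [|m IH] p b l cp p0 bp linl lp.
  exists (fun=> l); first by case.
  apply/funext => h; rewrite big_ord0; apply/eqP; rewrite eq_le.
  have := lp h; rewrite big_ord0 => -> /=.
  have := lp (- h); rewrite big_ord0 (linear_funN linl).
  by rewrite oppr_le0.
pose q h := \sum_(i < m) p (lift ord0 i) h.
have cq : convexf q by exact: convexf_sum.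
have q0 : q 0 = 0 by rewrite /q big1.
have lq h : l h <= p ord0 h + q h by have := lp h; rewrite big_ord_recl.
have [l1 [linl1 l1p l1q]] :=
  linear_le_add_split (cp ord0) cq (p0 ord0) q0 (bp ord0) linl lq.
have linB : linear (l - l1 : V -> R^o).
  move=> a x y; rewrite -[LHS]/(l _ - l1 _) linl linl1.
  by rewrite opprD addrACA -scalerBr.
have [ls lsp lsE] := IH _ _ (l - l1) (fun i => cp (lift ord0 i))
  (fun i => p0 (lift ord0 i)) (fun i => bp (lift ord0 i)) linB l1q.
exists (fun i => if unlift ord0 i is Some j then ls j else l1).
  by move=> i; case: unliftP => [j ->|->].
rewrite big_ord_recl unlift_none -[l](subrK l1) addrC lsE; congr (_ + _).
by apply: eq_bigr => i _; rewrite liftK.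
Qed.

End ConvexSums.

(** * Distance functions and norming functionals *)

Section Distance.
Context {R : realType} {X : normedModType R}.
Implicit Types (x y : X) (S : set X) (c : R).

Lemma dist_has_lbound x S : has_lbound [set `|x - y| | y in S].
Proof. by exists 0 => _ [y _ <-]. Qed.

Lemma dist_le x y S : S y -> dist x S <= `|x - y|.
Proof. by move=> Sy; apply: ge_inf; [exact: dist_has_lbound|exists y]. Qed.

Lemma le_dist x S c : S !=set0 -> (forall y, S y -> c <= `|x - y|) ->
  c <= dist x S.
Proof.
move=> [y Sy] cS; apply: lb_le_inf; first by exists `|x - y|, y.
by move=> _ [z Sz <-]; exact: cS.
Qed.

Lemma dist_ge0 x S : S !=set0 -> 0 <= dist x S.
Proof. by move=> S0; apply: le_dist. Qed.

Lemma dist_mem x S : S x -> dist x S = 0.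
Proof.
move=> Sx; apply/eqP; rewrite eq_le dist_ge0 ?andbT; last by exists x.
by rewrite (le_trans (dist_le x Sx))// subrr normr0.
Qed.

Lemma dist_lipschitz x y S : S !=set0 -> dist x S <= dist y S + `|x - y|.
Proof.
move=> S0; rewrite -lerBlDr; apply: le_dist => // z Sz.
rewrite lerBlDr; apply: le_trans (dist_le x Sz) _.
by rewrite [leRHS]addrC; exact: ler_distD.
Qed.

Lemma convexf_norm : convexf (fun x : X => `|x|).
Proof.
move=> x y t /andP[t0 t1]; apply: le_trans (ler_normD _ _) _.
by rewrite !normrZ !ger0_norm// subr_ge0.
Qed.

Lemma convexf_dist S : S !=set0 -> convex_set S -> convexf (fun x => dist x S).
Proof.
move=> S0 cS; apply: (@convexf_inf _ _ _ (fun x y => `|x - y|) (fun=> 0)) => //.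
  by move=> *; exact: (convex_setP cS).
move=> u1 u2 w1 w2 t Sw1 Sw2 t01.
by have := convexf_norm (u1 - w1) (u2 - w2) t01; rewrite !scalerBr addrACA opprD.
Qed.

(** Take a linear minorant of the norm recentred at [w]: the triangle inequality bounds it by the
    norm, and its value at [- w] forces equality at [w]. *)
Lemma norming_functional (w : X) : exists l : X -> R^o,
  [/\ linear l, forall h, `|l h| <= `|h| & l w = `|w|].
Proof.
have cp : convexf (fun h : X => `|h + w| - `|w|).
  by apply: convexf_shift; exact: convexf_norm.
have [|l linl lp] := convexf_linear_minorant cp; first by rewrite add0r subrr.
have lN h : l (- h) = - l h by exact: linear_funN.
have lle h : l h <= `|h|.
  by apply: le_trans (lp h) _; rewrite lerBlDr ler_normD.
exists l; split=> //.
  by move=> h; rewrite ler_norml lle andbT lerNl -lN -(normrN h) lle.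
apply/eqP; rewrite eq_le lle /=; have := lp (- w).
by rewrite addNr normr0 sub0r lN lerN2.
Qed.

End Distance.

(** * Ekeland's variational principle *)

Lemma le_addgt0 {R : realType} (a b : R) :
  (forall d : R, 0 < d -> a <= b + d) -> a <= b.
Proof. by move=> ab; apply/ler_addgt0Pr. Qed.

Lemma cvg_distP {R : realType} {V : normedModType R} (u : nat -> V) (l : V) :
  u n @[n --> \oo] --> l ->
  forall e : R, 0 < e -> exists N, forall n, (N <= n)%N -> `|l - u n| < e.
Proof. by move=> /cvgrPdist_lt ul e /ul [N _ uN]; exists N => n /uN. Qed.

Section Ekeland.
Context {R : realType} {X : completeNormedModType R}.
Implicit Types (u : nat -> X).

Lemma cauchy_tail_cvg u :
  (forall e : R, 0 < e -> exists N, forall n, (N <= n)%N -> `|u n - u N| < e) ->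
  exists l : X, u n @[n --> \oo] --> l.
Proof.
move=> uC; apply/cvg_ex; apply: cauchy_cvg; apply: cauchy_exP => e e0.
have [N uN] := uC e e0; exists (u N); exists N => // n /= Nn.
by rewrite -ball_normE /ball_/= distrC uN.
Qed.

(** Each iterate nearly minimizes [phi] over the points reachable from the previous one by descent
    at slope [e]; completeness makes the iterates converge. *)
Lemma ekeland (C : set X) (phi : X -> R) (c0 : X) (e : R) :
  closed C -> continuous phi -> (forall x, 0 <= phi x) -> C c0 -> 0 < e ->
  exists c, [/\ C c, phi c + e * `|c - c0| <= phi c0 &
    forall z, C z -> phi c <= phi z + e * `|z - c|].
Proof.
move=> clC cphi phi0 Cc0 e0.
(* The points reached from [c] by descent at slope at least [e]; the triangle inequality makes the
   relation transitive. *)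
pose S c z := C z /\ phi z + e * `|z - c| <= phi c.
have SS a b c : S a b -> S b c -> S a c.
  move=> [Cb ab] [Cc bc]; split=> //.
  have := ler_distD b c a; rewrite -(ler_pM2l e0); lra.
have /choice[g gP] : forall nc : nat * X, exists z, C nc.2 ->
    S nc.2 z /\ forall w, S nc.2 w -> phi z <= phi w + nc.1.+1%:R^-1.
  move=> [n c] /=; have [Cc|nCc] := pselect (C c); last by exists c.
  have hi : has_inf [set phi z | z in S c].
    split; last by exists 0 => _ [z _ <-].
    by exists (phi c), c => //; split=> //; rewrite subrr normr0 mulr0 addr0.
  have n0 : 0 < n.+1%:R^-1 :> R by rewrite invr_gt0.
  have [_ [z Sz <-] zlt] := inf_adherent n0 hi.
  exists z => _; split=> // w Sw; apply: le_trans (ltW zlt) _.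
  by rewrite lerD2r; apply: ge_inf; [exact: hi.2|exists w].
pose u : nat -> X := nat_rect (fun=> X) c0 (fun n c => g (n, c)).
have Cu n : C (u n).
  by elim: n => //= n Cun; have [[]] := gP (n, u n) Cun.
have Su n : S (u n) (u n.+1) by have [] := gP (n, u n) (Cu n).
have Snm n k : S (u n) (u (n + k)%N).
  elim: k => [|k IH]; last by rewrite addnS; exact: SS IH (Su _).
  by rewrite addn0; split=> //; rewrite subrr normr0 mulr0 addr0.
have hi : has_inf (range (phi \o u)).
  by split; [exists (phi (u 0)), 0%N|exists 0 => _ [n _ <-] /=].
(* Along [u], distances are controlled by the decrease of [phi], and little decrease remains once
   [phi (u N)] is near its infimum. *)
have [c uc] : exists c : X, u n @[n --> \oo] --> c.
  apply: cauchy_tail_cvg => d d0.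
  have [_ [N _ <-] /= Nlt] := inf_adherent (mulr_gt0 e0 d0) hi.
  exists N => n Nn; rewrite -(ltr_pM2l e0).
  have := (Snm N (n - N)%N).2; rewrite subnKC// => H.
  have : inf (range (phi \o u)) <= phi (u n).
    by apply: ge_inf; [exact: hi.2|exists n].
  by lra.
have Cc : C c by apply: (closed_cvg _ clC _ c uc); exact: nearW.
have phiu : phi (u n) @[n --> \oo] --> (phi c : R^o).
  by apply: continuous_cvg => //; exact: cphi.
have Sc n : S (u n) c.
  split=> //; apply: le_addgt0 => d d0.
  have [k k0 dk] : exists2 k : R, 0 < k & k + e * k = d.
    by exists (d / (1 + e)); [rewrite divr_gt0// addr_gt0|field; lra].
  have [N /(_ (n + (N + _))%N) cN] := cvg_distP uc k0.
  have [M cM] := cvg_distP (V := R^o) phiu k0.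
  have {}cN := cN M ltac:(by rewrite addnCA leq_addr).
  have {}cM := cM (n + (N + M))%N ltac:(by rewrite addnA leq_addl).
  have := (Snm n (N + M)%N).2; have := ler_norm (phi c - phi (u (n + (N + M))%N)).
  have := ler_distD (u (n + (N + M))%N) c (u n); rewrite -(ler_pM2l e0).
  have : e * `|c - u (n + (N + M))%N| < e * k by rewrite ltr_pM2l.
  by rewrite -dk; lra.
exists c; split=> //; first exact: (Sc 0%N).2.
(* A violating [z] would be reachable from every [u n], so [phi (u n.+1)], hence [phi c], would
   exceed [phi z] by at most [n.+1%:R^-1], contrary to the gap [d]. *)
move=> z Cz; apply: le_addgt0 => d d0; rewrite leNgt; apply/negP => ltz.
have Sz n : S (u n) z by apply: SS (Sc n) _; split=> //; lra.
have [n nd] : exists n, n.+1%:R^-1 < d.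
  exists (Num.truncn d^-1); rewrite invf_plt ?posrE//; exact: truncnS_gt.
have [_ /(_ z (Sz n)) /= gz] := gP (n, u n) (Cu n).
have cg : phi c + e * `|c - g (n, u n)| <= phi (g (n, u n)) := (Sc n.+1).2.
move: (n.+1%:R^-1) nd gz cg => k nd gz cg.
have : 0 <= e * `|c - g (n, u n)| by rewrite mulr_ge0// ltW.
have : 0 <= e * `|z - c| by rewrite mulr_ge0// ltW.
by lra.
Qed.

(* With [c] given by Ekeland's principle, the infimum over [z] in [C] of
   [`|y - z - h| + 2^-1 * `|z + h - c| - `|y - c|] is convex in [h] and nonnegative
   at 0; the opposite of a linear minorant of it is the required normal. *)
Lemma approx_projection_normal (C : set X) (y c0 : X) :
  closed C -> convex_set C -> C c0 ->
  exists c (l : X -> R^o), [/\ C c, `|y - c| <= `|y - c0|, linear l &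
    [/\ forall h, `|l h| <= 2 * `|h|, forall z, C z -> l (z - c) <= 0 &
        `|y - c| <= 2 * l (y - c)]].
Proof.
move=> clC cC Cc0; have half0 : 0 < 2^-1 :> R by rewrite invr_gt0.
have cphi : continuous (fun x : X => `|y - x|).
  by move=> x; apply: cvg_norm; apply: cvgB; [exact: cvg_cst|exact: cvg_id].
have [c [Cc cc0 cE]] := ekeland clC cphi (fun x => normr_ge0 (y - x)) Cc0 half0.
pose G (h z : X) : R := `|y - z - h| + 2^-1 * `|z + h - c| - `|y - c|.
pose b (h : X) : R := - (`|h| + 2^-1 * `|h|).
have bG h z : C z -> b h <= G h z.
  move=> Cz; rewrite /b /G; have := cE z Cz.
  have := ler_normD (y - z - h) h; rewrite subrK.
  have := ler_normB (z + h - c) h.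
  rewrite (_ : z + h - c - h = z - c); last by rewrite addrAC addrK.
  by lra.
have cG : convexf (fun h => inf [set G h z | z in C]).
  apply: (@convexf_inf _ _ _ G b) => //; first by exists c0.
    by move=> *; exact: (convex_setP cC).
  move=> u1 u2 w1 w2 t Cw1 Cw2 t01; rewrite /G.
  have := convexf_norm (y - w1 - u1) (y - w2 - u2) t01.
  have := convexf_norm (w1 + u1 - c) (w2 + u2 - c) t01.
  have conv v : t *: v + (1 - t) *: v = v.
    by rewrite -scalerDl (_ : t + (1 - t) = 1) ?scale1r//; ring.
  have -> : t *: (y - w1 - u1) + (1 - t) *: (y - w2 - u2) =
      y - (t *: w1 + (1 - t) *: w2) - (t *: u1 + (1 - t) *: u2).
    by rewrite !scalerBr addrACA -opprD addrACA -opprD conv.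
  have -> : t *: (w1 + u1 - c) + (1 - t) *: (w2 + u2 - c) =
      t *: w1 + (1 - t) *: w2 + (t *: u1 + (1 - t) *: u2) - c.
    by rewrite !(scalerBr, scalerDr) addrACA -opprD addrACA conv.
  by lra.
have [|l linl lG] := convexf_linear_minorant cG.
  apply: lb_le_inf; first by exists (G 0 c0), c0.
  by move=> _ [z Cz <-]; have := bG 0 z Cz; rewrite /b normr0; lra.
have {}lG h z : C z -> l h <= G h z.
  move=> Cz; apply: le_trans (lG h) _.
  by apply: ge_inf; [exists (b h) => _ [w Cw <-]; exact: bG|exists z].
have lN h : l (- h) = - l h by exact: linear_funN.
have lle h : - l h <= 2 * `|h|.
  rewrite -lN; apply: le_trans (lG (- h) c Cc) _; rewrite /G opprK.
  rewrite [c - h]addrC addrK normrN.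
  by have := ler_normD (y - c) h; have := normr_ge0 h; lra.
(* Three instances of [l h <= G h z] are used: [z = c] for the norm bound, [h = c - z] for the sign
   on [C], and [z = c], [h = y - c] for the last inequality. *)
exists c, (fun h => - l h); split=> //.
  by apply: le_trans cc0; rewrite lerDl mulr_ge0// ltW.
  by move=> a x z; rewrite linl opprD scalerN.
split.
- move=> h; rewrite normrN ler_norml; apply/andP; split.
    by rewrite lerNl; exact: lle.
  by have := lle (- h); rewrite lN normrN opprK.
- move=> z Cz; rewrite -lN opprB; apply: le_trans (lG _ z Cz) _.
  by rewrite /G [z + _]addrC subrK subrr normr0 opprB addrA subrK; lra.
- have := lG (y - c) c Cc.
  rewrite /G subrr normr0 [c + _]addrC subrK; lra.
Qed.

End Ekeland.

(** * Openness and metric regularity *)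

Section OperatorNorm.
Context {R : realType} {U V : normedModType R}.
Implicit Types (g : U -> V).

Lemma linear_continuousP g : linear g ->
  continuous g <-> exists2 c, 0 < c & forall h, `|g h| <= c * `|h|.
Proof.
move=> ling.
pose G : {linear U -> V} := HB.pack g (GRing.isLinear.Build _ _ _ _ _ ling).
split=> [/(linear_bounded_continuous G)/linear_boundedP/pinfty_ex_gt0|[c c0 gc]].
  by [].
apply/(linear_bounded_continuous G)/linear_boundedP; near=> r => x.
by apply: le_trans (gc x) _; rewrite ler_wpM2r//; near: r; apply: nbhs_pinfty_ge; rewrite num_real.
Unshelve. all: by end_near. Qed.

Lemma op_norm_bound g h : linear g -> continuous g ->
  `|g h| <= op_norm g * `|h|.
Proof.
move=> ling cg; have /linear_continuousP[//|c c0 gc] := cg.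
have [->|h0] := eqVneq h 0; first by rewrite (linear_fun0 ling) !normr0 mulr0.
have nh : 0 < `|h| by rewrite normr_gt0.
rewrite -ler_pdivrMr//; apply: ub_le_sup.
  exists c => _ [k /= k1 <-]; apply: le_trans (gc k) _.
  by rewrite -[leRHS]mulr1 ler_pM2l.
exists (`|h|^-1 *: h) => /=; first by rewrite normrZ normfV normr_id mulVf ?gt_eqF.
by rewrite (linear_funZ ling) normrZ normfV normr_id mulrC.
Qed.

Lemma op_norm_le g (c : R) : (forall h, `|h| <= 1 -> `|g h| <= c) ->
  op_norm g <= c.
Proof.
move=> gc; apply: ge_sup; first by exists `|g 0|, 0; rewrite /= ?normr0.
by move=> _ [h /= h1 <-]; exact: gc.
Qed.

End OperatorNorm.

Lemma dual_ballP (R : realType) (X : normedModType R) (l : X -> R^o) :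
  dual_ball X l <-> linear l /\ forall h, `|l h| <= `|h|.
Proof.
split=> [[[linl cl] l1]|[linl l1]].
  split=> // h; apply: le_trans (op_norm_bound h linl cl) _.
  by rewrite -[leRHS]mul1r ler_wpM2r.
split; last by apply: op_norm_le => h; apply: le_trans (l1 h).
split=> //; apply/linear_continuousP => //.
by exists 1 => // h; rewrite mul1r.
Qed.

Section OpenMapping.
Context {R : realType} {X Y : completeNormedModType R}.

(** The Baire half of the open mapping theorem: images of balls are dense in a neighbourhood of some
    point, and differences of two approximations move that point to 0. *)
Lemma surjective_almost_open (T : X -> Y) : linear T -> range T = setT ->
  exists2 k : R, 0 < k &
  forall w, exists2 h, `|h| <= k * `|w| & `|T h - w| <= `|w| / 4.
Proof.
move=> linT surjT.
pose A (n : nat) := T @` [set x | `|x| <= n%:R].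
have [n nd] : exists n, ~ dense (~` closure (A n)).
  (* Otherwise Baire's theorem gives a [y] outside every [closure (A n)], although [y] has a
     preimage whose norm is below some integer. *)
  apply: contrapT => /forallNP dA.
  have : dense (\bigcap_n ~` closure (A n)).
    apply: Baire => n; split; last exact: contrapT (dA n).
    by rewrite openC; exact: closed_closure.
  move=> /(_ setT) [||y [_ yA]]; [by exists 0|exact: openT|].
  have [x _ xy] : range T y by rewrite surjT.
  apply: (yA (Num.truncn `|x|).+1 I); apply: subset_closure; exists x => //=.
  by rewrite ltW// truncnS_gt.
have [B [[y0 By0] oB BA]] : exists B : set Y, [/\ B !=set0, open B & B `<=` closure (A n)].
  move: nd => /existsNP[B /not_implyP[B0 /not_implyP[oB BA]]].
  exists B; split=> // y By; apply: contrapT => yA; apply: BA; exists y.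
  by split.
have [r r0 rB] : exists2 r : R, 0 < r & forall y, `|y0 - y| < r -> B y.
  have /nbhs_ballP[r /= r0 rB] : nbhs y0 B by exact: open_nbhs_nbhs.
  by exists r => // y yr; apply: rB; rewrite -ball_normE.
have approx y (e : R) : 0 < e -> `|y0 - y| < r ->
    exists2 x, `|x| <= n%:R & `|y - T x| < e.
  move=> e0 yr; have := BA _ (rB _ yr) (ball y e) (nbhsx_ballx y _ e0).
  by move=> [_ [[x xn <-]]]; rewrite -ball_normE; exists x.
have k0 : 0 < 4 * (n%:R + 1) / r by rewrite divr_gt0// mulr_gt0// ltr_pwDr.
exists (4 * (n%:R + 1) / r) => // w.
have [->|w0] := eqVneq w 0.
  by exists 0; rewrite ?(linear_fun0 linT) ?subr0 !normr0 ?mulr0 ?mul0r.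
have nw : 0 < `|w| by rewrite normr_gt0.
(* [s *: w] has norm [r / 2], hence [y0 + s *: w] is in the ball; two errors of [r / 16] add up to
   [s] times a quarter of the norm of [w]. *)
pose s := r / (2 * `|w|).
have s0 : 0 < s by rewrite divr_gt0// mulr_gt0.
have e0 : 0 < r / 16 by rewrite divr_gt0.
have [x1 x1n x1T] := approx y0 _ e0 ltac:(by rewrite subrr normr0).
have [|x2 x2n x2T] := approx (y0 + s *: w) _ e0.
  rewrite opprD addNKr normrN normrZ gtr0_norm// /s.
  by rewrite invfM mulrA divfK ?gt_eqF// gtr_pMr// invf_lt1// ltr1n.
exists (s^-1 *: (x2 - x1)).
  rewrite normrZ gtr0_norm ?invr_gt0// mulrC ler_pdivrMr//.
  have -> : 4 * (n%:R + 1) / r * `|w| * s = 2 * (n%:R + 1) :> R.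
    by rewrite /s; field; rewrite !gt_eqF.
  have := ler_normB x2 x1; lra.
have -> : T (s^-1 *: (x2 - x1)) - w =
    s^-1 *: ((y0 - T x1) - (y0 + s *: w - T x2)).
  rewrite (linear_funZ linT) (linear_funB linT).
  rewrite -[w in LHS](scalerK (lt0r_neq0 s0)) -scalerBr; congr (_ *: _).
  by rewrite opprB opprD [T x2 + (_ + _)]addrA [RHS]addrC addrACA subrK [RHS]addrA [RHS]addrAC.
rewrite normrZ gtr0_norm ?invr_gt0// mulrC ler_pdivrMr//.
have -> : `|w| / 4 * s = r / 16 + r / 16 :> R.
  by rewrite /s; field; rewrite !gt_eqF.
by apply: le_trans (ler_normB _ _) _; apply: lerD; exact: ltW.
Qed.

(* Ekeland's principle gives a point where [`|F x - z|] cannot decrease at rate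
   [(4 * k)^-1]; a step halving the residual forces it to be 0 there. *)
Lemma solve_by_ekeland (F : X -> Y) (z : Y) (x0 : X) (k : R) :
  continuous F -> 0 < k ->
  (forall x, `|x - x0| <= 4 * k * `|F x0 - z| -> `|F x - z| <= `|F x0 - z| ->
    exists2 x', `|x' - x| <= k * `|F x - z| & `|F x' - z| <= `|F x - z| / 2) ->
  exists2 x, F x = z & `|x - x0| <= 4 * k * `|F x0 - z|.
Proof.
move=> cF k0 step.
have cphi : continuous (fun x : X => `|F x - z|).
  by move=> x; apply: cvg_norm; apply: cvgB; [exact: cF|exact: cvg_cst].
have e0 : 0 < (4 * k)^-1 by rewrite invr_gt0 mulr_gt0.
have [x [_ xx0 xmin]] := ekeland closedT cphi (fun x => normr_ge0 (F x - z)) (I : setT x0) e0.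
have k4 : 0 < 4 * k by rewrite mulr_gt0.
have xle : `|x - x0| <= 4 * k * `|F x0 - z|.
  by rewrite -ler_pdivrMl//; apply: le_trans xx0; rewrite lerDr.
exists x => //.
have [|x' x'x Fx'] := step x xle.
  by apply: le_trans xx0; rewrite lerDl mulr_ge0// ltW.
(* The step costs at most a quarter of the residual in the Ekeland inequality but removes half of
   it, so the residual is 0. *)
have := xmin x' I; have : (4 * k)^-1 * `|x' - x| <= `|F x - z| / 4.
  rewrite ler_pdivrMl//; apply: le_trans x'x _.
  by rewrite le_eqVlt; apply/orP; left; apply/eqP; field.
move=> H1 H2; apply/eqP; rewrite -subr_eq0 -normr_le0; lra.
Qed.

End OpenMapping.

(** * First-order estimates for smooth maps *)

Lemma is_derive_eps {R : realType} (g : R -> R) (a D : R) :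
  (forall e : R, 0 < e -> exists2 d : R, 0 < d & forall h, `|h| < d ->
     `|g (h + a) - g a - h * D| <= e * `|h|) ->
  is_derive a 1 g D.
Proof.
move=> gD.
have H : h^-1 *: (g (h *: 1 + a) - g a) @[h --> 0^'] --> (D : R^o).
  apply/cvgrPdist_le => e e0; have [d d0 dg] := gD e e0.
  near=> h.
  have h0 : h != 0 by near: h; exact: nbhs_dnbhs_neq.
  have hd : `|h| < d by near: h; apply: dnbhs0_lt.
  have := dg h hd; rewrite scaler1 -ler_pdivrMr ?normr_gt0//; apply: le_trans.
  rewrite -normfV mulrC -normrM distrC mulrBr mulrA mulVf// mul1r.
  by rewrite /GRing.scale/=.
by apply: DeriveDef; [exact: cvgP H|exact: cvg_lim H].
Unshelve. all: by end_near. Qed.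

Section DifferentialEstimates.
Context {R : realType} {X Y : normedModType R} (f : X -> Y).

Lemma linear_diff x : linear ('d f x).
Proof. exact: linearP. Qed.

Lemma diff_eps x : differentiable f x -> forall e : R, 0 < e ->
  exists2 d : R, 0 < d & forall y, `|y - x| < d ->
    `|f y - f x - 'd f x (y - x)| <= e * `|y - x|.
Proof.
move=> /diff_locallyP[_ /eqaddoP fo] e e0.
have /nbhs_normP[d /= d0 dP] := fo e e0; exists d => // y yd.
have := dP (y - x); rewrite /= sub0r normrN => /(_ yd).
by rewrite !fctE/= subrK opprD addrA.
Qed.

Lemma C1_eps x : continuously_differentiable f -> forall e : R, 0 < e ->
  exists2 d : R, 0 < d & forall y, `|y - x| < d ->
    forall h, `|'d f y h - 'd f x h| <= e * `|h|.
Proof.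
move=> [fd fC] e e0; have /cvgrPdist_le /(_ e e0)/nbhs_normP[d /= d0 dP] := fC x.
exists d => // y yd h.
have ling : linear ('d f y \- 'd f x).
move=> a u v; have dE z : 'd f z (a *: u + v) = a *: 'd f z u + 'd f z v.
    exact: linear_diff.
  by rewrite /= !dE scalerBr opprD addrACA.
have cg : continuous ('d f y \- 'd f x).
  by move=> z; apply: cvgB; exact: diff_continuous.
apply: le_trans (op_norm_bound h ling cg) _; rewrite ler_wpM2r//.
have := dP y; rewrite /= [`|x - y|]distrC sub0r normrN => /(_ yd); apply: le_trans.
exact: ler_norm.
Qed.

(** A functional norming the error vector reduces the claim to the scalar mean value theorem on the
    segment from [u] to [v]. *)
Lemma mean_value_inequality (T : X -> Y) (x0 : X) (r M : R) :
  linear T -> (forall x, differentiable f x) ->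
  (forall x, `|x - x0| < r -> forall h, `|'d f x h - T h| <= M * `|h|) ->
  forall u v, `|u - x0| < r -> `|v - x0| < r ->
    `|f v - f u - T (v - u)| <= M * `|v - u|.
Proof.
move=> linT fd TM u v ur vr.
have [l [linl l1 lw]] := norming_functional (f v - f u - T (v - u)).
pose p (t : R) := u + t *: (v - u).
(* Subtracting the linear term makes [g 1 - g 0] the value of [l] at the error vector. *)
pose g (t : R) : R := l (f (p t)) - t * l (T (v - u)).
have pS h t : p (h + t) - p t = h *: (v - u).
  by rewrite /p scalerDl opprD addrACA subrr add0r addrK.
have gD (t : R) : is_derive t 1 g (l ('d f (p t) (v - u)) - l (T (v - u))).
  apply: is_derive_eps => e e0.
  have n0 : 0 < `|v - u| + 1 by rewrite ltr_wpDl.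
  have [d d0 dP] := diff_eps (fd (p t)) (divr_gt0 e0 n0).
  exists (d / (`|v - u| + 1)); first exact: divr_gt0.
  move=> h hd.
  have hvu : `|h *: (v - u)| <= `|h| * (`|v - u| + 1).
    by rewrite normrZ ler_wpM2l// lerDl.
  have hvd : `|h *: (v - u)| < d.
    by apply: le_lt_trans hvu _; rewrite -ltr_pdivlMr.
  have := dP (p (h + t)); rewrite pS => /(_ hvd)/le_trans H.
  apply: le_trans (H (e * `|h|) _).
  - rewrite (linear_funZ (linear_diff _)) /g.
    set a := f (p (h + t)); set b := f (p t); set D := 'd f (p t) (v - u).
    have -> : l a - (h + t) * l (T (v - u)) - (l b - t * l (T (v - u))) -
        h * (l D - l (T (v - u))) = l (a - b - h *: D).
      by rewrite !(linear_funB linl) (linear_funZ linl) /GRing.scale/=; ring.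
    exact: l1.
  - apply: le_trans (ler_wpM2l _ hvu) _; first by rewrite ltW// divr_gt0.
    by rewrite le_eqVlt; apply/orP; left; apply/eqP; field; rewrite gt_eqF.
have gc : {within `[0, 1], continuous g}.
  apply: continuous_subspaceT => t.
  apply: differentiable_continuous; apply/derivable1_diffP.
  exact: ex_derive.
have [t] := MVT ltr01 (fun t _ => gD t) gc.
rewrite in_itv/= => /andP[t0 t1].
rewrite /g /p scale1r scale0r mul0r mul1r addr0 !subr0 mulr1 [u + _]addrC subrK => E.
rewrite -lw (linear_funB linl) (linear_funB linl).
have -> : l (f v) - l (f u) - l (T (v - u)) = l ('d f (p t) (v - u)) - l (T (v - u)).
  by rewrite -E; ring.
rewrite -(linear_funB linl); apply: le_trans (ler_norm _) _.
apply: le_trans (l1 _) _; apply: TM.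
have -> : p t - x0 = t *: (v - x0) + (1 - t) *: (u - x0).
  rewrite !scalerBr addrACA -opprD -scalerDl [t + _]addrC subrK scale1r.
  by rewrite /p scalerBl scale1r scalerBr addrCA.
have [t0' t1'] : 0 <= t /\ 0 <= 1 - t by lra.
apply: le_lt_trans (ler_normD _ _) _; rewrite !normrZ !ger0_norm//.
have : t * `|v - x0| < t * r by rewrite ltr_pM2l.
have : (1 - t) * `|u - x0| <= (1 - t) * r by rewrite ler_wpM2l// ltW.
by lra.
Qed.

End DifferentialEstimates.

(* [k] is a modulus of openness and [L] a Lipschitz constant, both for [f] and
   for its derivatives, on balls of radius [r] in [X] and [s] in [Y]. *)
Record regular_near {R : realType} {X Y : normedModType R} (f : X -> Y)
    (x0 : X) (k L r s : R) : Prop := {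
  reg_k_gt0 : 0 < k;
  reg_L_gt0 : 0 < L;
  reg_r_gt0 : 0 < r;
  reg_image : forall x, `|x - x0| < r -> `|f x - f x0| < s;
  reg_open : forall x w, `|x - x0| < r ->
    exists2 h, 'd f x h = w & `|h| <= k * `|w|;
  reg_metric : forall x z, `|x - x0| < r -> `|z - f x0| < s ->
    exists2 y, f y = z & `|y - x| <= k * `|f x - z|;
  reg_lip : forall x y, `|x - x0| < r -> `|y - x0| < r ->
    `|f x - f y| <= L * `|x - y|;
  reg_dlip : forall x h, `|x - x0| < r -> `|'d f x h| <= L * `|h| }.

Lemma surjective_regular_near {R : realType} {X Y : completeNormedModType R}
    (f : X -> Y) (x0 : X) :
  continuously_differentiable f -> range ('d f x0) = setT ->
  exists k L r s, regular_near f x0 k L r s.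
Proof.
move=> fC1 surj; have [fd _] := fC1.
have linT := linear_diff f x0; pose T := 'd f x0 : X -> Y.
have [k k0 kP] := surjective_almost_open linT surj.
have cT : continuous T by exact: diff_continuous.
have [M M0 MP] : exists2 c, 0 < c & forall h, `|T h| <= c * `|h|.
  by apply/(linear_continuousP linT).
(* Replacing [T] by a derivative within [eta] adds at most a quarter of the residual to the quarter
   left by [kP]: this is the halving step of [solve_by_ekeland]. *)
pose eta := (4 * k)^-1.
have eta0 : 0 < eta by rewrite invr_gt0 mulr_gt0.
have etak w : eta * (k * w) = w / 4 by rewrite /eta; field; rewrite gt_eqF.
have [d d0 dP] := C1_eps x0 fC1 eta0.
have mvi := mean_value_inequality linT fd dP.
have Mn : 0 < M + eta by rewrite addr_gt0.
have flip x y : `|x - x0| < d -> `|y - x0| < d ->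
    `|f x - f y| <= (M + eta) * `|x - y|.
  move=> xd yd; have := mvi y x yd xd; have := MP (x - y).
  have := ler_normD (f x - f y - T (x - y)) (T (x - y)).
  by rewrite subrK; lra.
have dlip x h : `|x - x0| < d -> `|'d f x h| <= (M + eta) * `|h|.
  move=> xd; have := dP x xd h; have := MP h.
  have := ler_normD ('d f x h - T h) (T h).
  by rewrite subrK; lra.
(* From a point within [r <= s] of [x0], Ekeland's principle moves by at most [4 * k * (2 * s)] and
   the trial step by [k * (2 * s)]; the total stays below [d]. *)
pose s := d / (2 + 10 * k).
have q0 : 0 < 2 + 10 * k by rewrite addr_gt0// mulr_gt0.
have s0 : 0 < s by rewrite divr_gt0.
have sd : 2 * s + 5 * k * (2 * s) = d.
  by rewrite /s; field; rewrite gt_eqF.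
have ks : 0 < 5 * k * (2 * s).
  by apply: mulr_gt0; exact: mulr_gt0.
pose r := s / (1 + (M + eta)).
have Mn1 : 0 < 1 + (M + eta) by rewrite addr_gt0.
have r0 : 0 < r by rewrite divr_gt0.
have rs : r + (M + eta) * r = s by rewrite /r; field; rewrite gt_eqF.
have Mr : 0 < (M + eta) * r by rewrite mulr_gt0.
have lerd x : `|x - x0| < r -> `|x - x0| < d by move=> /lt_trans; apply; lra.
have image x : `|x - x0| < r -> `|f x - f x0| < s.
  move=> xr; have x0d : `|x0 - x0| < d by rewrite subrr normr0.
  have := flip x x0 (lerd _ xr) x0d.
  have : (M + eta) * `|x - x0| <= (M + eta) * r by rewrite ler_pM2l// ltW.
  by lra.
exists (4 * k), (M + eta), r, s; split => //; rewrite ?mulr_gt0//.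
- move=> x w /lerd xd.
  have cdx : continuous ('d f x) by exact: diff_continuous.
  have d00 : 'd f x 0 = 0 by exact: linear_fun0 (linear_diff f x).
  have [y _ _|h hw] := @solve_by_ekeland _ _ _ ('d f x) w 0 k cdx k0.
    have [h hk hT] := kP (w - 'd f x y).
    rewrite distrC; exists (y + h); first by rewrite addrC addKr.
    have -> : 'd f x (y + h) - w =
        ('d f x h - T h) + (T h - (w - 'd f x y)).
      rewrite (linear_funD (linear_diff f x)).
      by rewrite addrA subrK opprB addrA ['d f x y + _]addrC.
    apply: le_trans (ler_normD _ _) _.
    have := dP x xd h.
    have : eta * `|h| <= eta * (k * `|w - 'd f x y|) by rewrite ler_pM2l.
    by rewrite etak; lra.
  rewrite d00 sub0r normrN subr0 => hle; exists h => //.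
- move=> x z xr zr.
  have fxz : `|f x - z| <= 2 * s.
    have := ler_distD (f x0) (f x) z; have := image x xr.
    by rewrite (distrC (f x0) z); lra.
  have cf : continuous f by move=> y; exact: differentiable_continuous.
  apply: solve_by_ekeland => // y yx yz.
  have kz : k * `|f x - z| <= k * (2 * s) by rewrite ler_pM2l.
  have kz' : k * `|f y - z| <= k * `|f x - z| by rewrite ler_pM2l.
  have [h hk hT] := kP (z - f y).
  move: (hk) (hT); rewrite [`|z - f y|]distrC => hk' hT'.
  exists (y + h); first by rewrite addrC addKr.
  have yd : `|y - x0| < d.
    have := ler_distD x y x0; lra.
  have yhd : `|y + h - x0| < d.
    have := ler_normD (y - x0) h; have := ler_distD x y x0.
    by rewrite addrAC; lra.
  have := mvi y (y + h) yd yhd; rewrite [y + h - y]addrC addKr => mv.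
  have -> : f (y + h) - z = (f (y + h) - f y - T h) + (T h - (z - f y)).
    by rewrite addrA subrK opprB addrA subrK.
  apply: le_trans (ler_normD _ _) _.
  have : eta * `|h| <= eta * (k * `|f y - z|) by rewrite ler_pM2l.
  by rewrite etak; lra.
- by move=> x y /lerd xd /lerd yd; exact: flip.
- by move=> x h /lerd; exact: dlip.
Qed.

(** * Normal cones to smooth preimages of convex sets *)

(* The normal cone at 0 of the linearization at [x] of [f @^-1` S]; it is the image
   of the normal cone to [S] at [f x] under the adjoint of a surjective ['d f x]. *)
Definition lin_normal {R : realType} {X Y : normedModType R} (f : X -> Y)
    (S : set Y) (x : X) : set (X -> R^o) :=
  [set l | dual X l /\ forall h, S (f x + 'd f x h) -> l h <= 0].

Section NormalCones.
Context {R : realType} {X : normedModType R}.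
Implicit Types (A : set X) (x : X) (l : X -> R^o).

(** The limsup as a local inequality without quotient; it may include [y = x], where both sides
    vanish. *)
Lemma eps_normalP (e : R) A x l : eps_normal e A x l <->
  dual X l /\ forall e' : R, e < e' -> exists2 d : R, 0 < d &
    forall y, A y -> `|y - x| < d -> l (y - x) <= e' * `|y - x|.
Proof.
split=> [[dl le]|[dl le]]; split=> //.
  move=> e' ee'; have le' : (limf_esup (fun y : X => (l (y - x) / `|y - x|)%:E)
      (within A x^') < e'%:E)%E by rewrite (le_lt_trans le)// lte_fin.
  have [_ [V FV <-] Ve'] := ereal_inf_lt le'.
  have /nbhs_normP[d /= d0 dV] := FV; exists d => // y Ay yd.
  have [->|yx] := eqVneq y x.
    by rewrite subrr normr0 mulr0 (linear_fun0 dl.1).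
  rewrite -ler_pdivrMr ?normr_gt0 ?subr_eq0// -lee_fin.
  apply: le_trans (ltW Ve'); apply: ereal_sup_ubound; exists y => //.
  by apply: dV => //; rewrite /= distrC.
apply/lee_addgt0Pr => d d0; rewrite -EFinD.
have [|r r0 rA] := le (e + d); first by rewrite ltrDl.
pose V := [set y : X | [/\ A y, y != x & `|y - x| < r]].
apply: (@le_trans _ _ (ereal_sup ((fun y : X => (l (y - x) / `|y - x|)%:E) @` V))).
  apply: ereal_inf_lbound; exists V => //.
  apply/nbhs_normP; exists r => //= y yr yx Ay.
  by split=> //; rewrite distrC.
apply: ge_ereal_sup => _ [y [Ay yx yr] <-]; rewrite lee_fin.
by rewrite ler_pdivrMr ?normr_gt0 ?subr_eq0//; exact: rA.
Qed.

Lemma sub_limiting_normal A x : A x -> frechet_normal A x `<=` limiting_normal A x.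
Proof.
move=> Ax l Nl; split; first by case: Nl.
exists (fun=> x), (fun=> 0), (fun=> l); split=> //.
- exact: cvg_cst.
- exact: cvg_cst.
- by split=> [h|//]; exact: cvg_cst.
Qed.

End NormalCones.

(** Uniform boundedness principle: convergent scalar sequences are bounded. *)
Lemma weak_star_bounded {R : realType} {X : completeNormedModType R}
    (us : nat -> X -> R^o) (l : X -> R^o) :
  (forall n, dual X (us n)) -> weak_star_cvg us l ->
  exists2 B : R, 0 < B & forall n h, `|us n h| <= B * `|h|.
Proof.
move=> dus usl.
have usB : uniform_bounded (range us).
  apply: Banach_Steinhauss.
    move=> _ [n _ <-]; have [linu cu] := dus n; split=> // r.
    have /(linear_continuousP linu)[c c0 uc] := cu.
    exists (c * r) => x xr; apply: le_trans (uc x) _.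
    by rewrite ler_pM2l.
  move=> x; have /cvg_seq_bounded : cvgn (fun n => us n x : R^o) by apply: cvgP (usl x).
  move=> /pinfty_ex_gt0[M M0 Mb]; exists M => _ [n _ <-]; exact: Mb.
have [B BP] := usB 1.
exists (`|B| + 1); first by rewrite ltr_wpDl.
move=> n h; have [linu cu] := dus n.
apply: le_trans (op_norm_bound h linu cu) _; rewrite ler_wpM2r//.
apply: op_norm_le => k k1; apply: le_trans (BP _ _ _ k1) _; first by exists n.
by rewrite (le_trans (ler_norm _))// lerDl.
Qed.

Section RegularNormals.
Context {R : realType} {X Y : completeNormedModType R} {f : X -> Y} {x0 : X}
  {k L r s : R}.
Context (fC1 : continuously_differentiable f)
  (reg : regular_near f x0 k L r s).

(** For [y] in the preimage, openness of the derivative corrects [y - x] into the linearized set at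
    a cost of first-order remainder size. *)
Lemma lin_normal_frechet (S : set Y) x : `|x - x0| < r ->
  lin_normal f S x `<=` frechet_normal (f @^-1` S) x.
Proof.
move=> xr l [dl lS]; apply/eps_normalP; split=> // e e0.
have [linl /(linear_continuousP linl)[c c0 lc]] := dl.
have k0 := reg_k_gt0 reg.
have [d d0 dP] := diff_eps (fC1.1 x) (divr_gt0 e0 (mulr_gt0 c0 k0)).
exists d => // y Sy yd; have := dP y yd.
have [h hE hk] := reg_open reg (f y - f x - 'd f x (y - x)) xr.
have : l (y - x + h) <= 0.
  apply: lS; rewrite (linear_funD (linear_diff f x)) hE.
  by rewrite (addrC ('d f x (y - x))) subrK addrC subrK.
have := lc h; rewrite ler_norml => /andP[lh _] lyh hle.
have : k * `|f y - f x - 'd f x (y - x)| <= k * (e / (c * k) * `|y - x|).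
  by rewrite ler_pM2l.
have -> : k * (e / (c * k) * `|y - x|) = e * `|y - x| / c.
  by field; rewrite !gt_eqF.
move=> /(le_trans hk); rewrite ler_pdivlMr// mulrC => ch.
by move: lyh; rewrite (linear_funD linl); lra.
Qed.

(** By convexity [f x + t f'(x) h] stays in [S]; metric regularity lifts it to a point [y] of the
    preimage at distance o(t) from [x + t h], where the normal inequality applies. The bound
    obtained is global in [h], as needed along sequences. *)
Lemma eps_normal_lin (e : R) (S : set Y) x l h : 0 <= e -> convex_set S ->
  S (f x) -> `|x - x0| < r -> eps_normal e (f @^-1` S) x l ->
  S (f x + 'd f x h) -> l h <= e * `|h|.
Proof.
move=> e0 cS Sx xr /eps_normalP[[linl cl] le] Sh.
have /(linear_continuousP linl)[c c0 lc] := cl.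
have k0 := reg_k_gt0 reg.
suff H (g : R) : 0 < g -> l h <= (e + 2 * g) * `|h|.
  have [->|hn0] := eqVneq h 0; first by rewrite (linear_fun0 linl) normr0 mulr0.
  have hn : 0 < `|h| by rewrite normr_gt0.
  apply: le_addgt0 => d d0; have := H (d / (2 * `|h|)) ltac:(by rewrite divr_gt0// mulr_gt0).
  have -> : (e + 2 * (d / (2 * `|h|))) * `|h| = e * `|h| + d by field; rewrite gt_eqF.
  by [].
(* [eta] is the remainder rate at which the errors due to [y] differing from [x + t h] add exactly
   [g], as recorded in [etaE]. *)
move=> g0; pose q := k * (e + g + c).
have q0 : 0 < q by rewrite mulr_gt0// ltr_wpDr ?ltW// ltr_wpDl.
pose eta := g / q; have eta0 : 0 < eta by rewrite divr_gt0.
have etaE : (e + g) * (1 + k * eta) + c * (k * eta) = e + 2 * g.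
  have egc : 0 < e + g + c by lra.
  by rewrite /eta /q; field; rewrite !gt_eqF.
have [d1 d10 d1P] := le (e + g) ltac:(by rewrite ltrDl).
have [d2 d20 d2P] := diff_eps (fC1.1 x) eta0.
have fxs := reg_image reg xr.
have small (a b : R) : 0 <= a -> 0 < b -> \forall t \near 0^'+, t * a < b.
  move=> a0 b0; have ab : 0 < b / (a + 1) by rewrite divr_gt0// ltr_wpDl.
  near=> t; have : t < b / (a + 1) by near: t; exact: nbhs_right_lt.
  have t0 : 0 < t by near: t; exact: nbhs_right_gt.
  by rewrite ltr_pdivlMr ?ltr_wpDl//; lra.
have ke0 : 0 <= 1 + k * eta by rewrite addr_ge0// mulr_ge0// ltW.
near (0 : R)^'+ => t.
have t0 : 0 < t by near: t; exact: nbhs_right_gt.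
have t1 : t < 1 by near: t; exact: nbhs_right_lt.
have nth : `|t *: h| = t * `|h| by rewrite normrZ gtr0_norm.
have td1 : t * ((1 + k * eta) * `|h|) < d1.
  by near: t; apply: small => //; rewrite mulr_ge0.
have td2 : t * `|h| < d2 by near: t; exact: small.
have tr : t * `|h| < r - `|x - x0| by near: t; apply: small; rewrite ?subr_gt0.
have ts : t * `|'d f x h| < s - `|f x - f x0|.
  by near: t; apply: small; rewrite ?subr_gt0.
pose z := f x + t *: 'd f x h.
have Sz : S z.
  have := convex_setP cS Sh Sx (t := t); rewrite (ltW t0) (ltW t1) => /(_ isT).
  by rewrite scalerDr addrAC -scalerDl [t + _]addrC subrK scale1r.
have [y fy yle] : exists2 y, f y = z & `|y - (x + t *: h)| <= k * `|f (x + t *: h) - z|.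
  apply: (reg_metric reg).
    apply: le_lt_trans (_ : `|x - x0| + t * `|h| < _); last by lra.
    by rewrite addrAC (le_trans (ler_normD _ _))// nth.
  apply: le_lt_trans (_ : `|f x - f x0| + t * `|'d f x h| < _); last by lra.
  by rewrite /z addrAC (le_trans (ler_normD _ _))// normrZ gtr0_norm.
have Sy : (f @^-1` S) y by rewrite /preimage/= fy.
have : `|f (x + t *: h) - z| <= eta * (t * `|h|).
  have := d2P (x + t *: h); rewrite [x + _ - x]addrC addKr nth => /(_ td2).
  by rewrite (linear_funZ (linear_diff f x)) /z opprD addrA.
rewrite -(ler_pM2l k0) => /(le_trans yle) {}yle.
have lth : t * l h <= l (y - x) + c * (k * (eta * (t * `|h|))).
  have -> : t * l h = l (t *: h) by rewrite (linear_funZ linl).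
  have -> : t *: h = (y - x) - (y - (x + t *: h)).
    by rewrite opprB [RHS]addrC addrA subrK [x + _]addrC addrK.
  rewrite (linear_funB linl (y - x)) lerD2l.
  apply: le_trans (ler_norm _) _; rewrite normrN; apply: le_trans (lc _) _.
  by rewrite ler_pM2l.
have yx : `|y - x| <= t * ((1 + k * eta) * `|h|).
  have -> : y - x = t *: h + (y - (x + t *: h)).
    by rewrite [RHS]addrC opprD addrA subrK.
  by apply: le_trans (ler_normD _ _) _; rewrite nth; lra.
have := d1P y Sy (le_lt_trans yx td1).
have : (e + g) * `|y - x| <= (e + g) * (t * ((1 + k * eta) * `|h|)).
  by rewrite ler_pM2l// ltr_wpDl.
by move=> H1 H2; rewrite -(ler_pM2l t0) -etaE; lra.
Unshelve. all: by end_near. Qed.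

(** The global inequality [eps_normal_lin] holds at the nearby points [u n]; a small correction
    moves [h] into their linearized sets before passing to the limit. *)
Lemma limiting_normal_lin (S : set Y) x : convex_set S -> S (f x) ->
  `|x - x0| < r -> limiting_normal (f @^-1` S) x `<=` lin_normal f S x.
Proof.
move=> cS Sx xr l [dl [u [e [us [Au ux e0 e_0 [usl Nus]]]]]].
have dus n : dual X (us n) by have /eps_normalP[] := Nus n.
have [B B0 usB] := weak_star_bounded dus usl.
split=> // h Sh.
have k0 := reg_k_gt0 reg; have L0 := reg_L_gt0 reg.
(* The terms bound, in units of [q], the weak* error at [h], the [e n] term at [h + p], and the
   value of [us n] at the correction [p]. *)
pose K := 1 + (`|h| + k) + B * k.
have K0 : 0 < K by rewrite /K; have := mulr_gt0 B0 k0; have := normr_ge0 h; lra.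
suff H (q : R) : 0 < q -> q <= 1 -> l h <= q * K.
  apply: le_addgt0 => d d0; rewrite add0r.
  pose q := Num.min (d / K) 1.
  have q0 : 0 < q by rewrite lt_min ltr01 andbT divr_gt0.
  apply: le_trans (H q q0 _) _; first by rewrite ge_min lexx orbT.
  by rewrite -ler_pdivlMr// ge_min lexx.
move=> q0 q1.
have q20 : 0 < q / 2 by lra.
have [d d0 dP] := C1_eps x fC1 (divr_gt0 q20 (ltr_wpDl (normr_ge0 h) ltr01)).
have qL : 0 < q / 2 / L by rewrite divr_gt0.
have xr' : 0 < r - `|x - x0| by rewrite subr_gt0.
have N1 := (cvgrPdist_lt _ _).1 ux _ d0.
have N2 := (cvgrPdist_lt _ _).1 ux _ qL.
have N3 := (cvgrPdist_lt _ _).1 ux _ xr'.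
have N4 := (cvgrPdist_lt _ _).1 e_0 _ q0.
have N5 := (cvgrPdist_lt _ _).1 (usl h) _ q0.
near \oo => n.
have un_d : `|x - u n| < d by near: n; exact: N1.
have un_L : `|x - u n| < q / 2 / L by near: n; exact: N2.
have un_r : `|x - u n| < r - `|x - x0| by near: n; exact: N3.
have en : `|0 - e n| < q by near: n; exact: N4.
have usn : `|l h - us n h| < q by near: n; exact: N5.
have unr : `|u n - x0| < r.
  by have := ler_distD x (u n) x0; rewrite (distrC (u n) x); lra.
(* The mismatch between the linearizations at [x] and at [u n], small since [f] is continuously
   differentiable; [p] compensates for it. *)
pose w := f x + 'd f x h - (f (u n) + 'd f (u n) h).
have wq : `|w| <= q.
  have -> : w = (f x - f (u n)) + ('d f x h - 'd f (u n) h).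
    by rewrite /w opprD addrACA.
  have := ler_normD (f x - f (u n)) ('d f x h - 'd f (u n) h).
  have := reg_lip reg xr unr.
  have : L * `|x - u n| < q / 2 by rewrite -ltr_pdivlMl// mulrC.
  have := dP (u n); rewrite distrC => /(_ un_d h).
  rewrite (distrC ('d f (u n) h)) => H.
  have : q / 2 / (`|h| + 1) * `|h| <= q / 2.
    by rewrite -mulrA ler_piMr ?(ltW q20)// mulrC ler_pdivrMr ?ltr_wpDl// mul1r lerDl.
  by lra.
have [p pE pk] := reg_open reg w unr.
have Sp : S (f (u n) + 'd f (u n) (h + p)).
  by rewrite (linear_funD (linear_diff f _)) pE addrA /w addrC subrK.
have := eps_normal_lin (e0 n) cS (Au n) unr (Nus n) Sp.
rewrite (linear_funD (dus n).1).
have : e n * `|h + p| <= q * (`|h| + k).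
  apply: ler_pM => //; first by move: en; rewrite sub0r normrN ltr_norml => /andP[_ /ltW].
  apply: le_trans (ler_normD _ _) _; rewrite lerD2l (le_trans pk)//.
  by rewrite -[leRHS]mulr1 ler_pM2l// (le_trans wq).
have := usB n p; rewrite ler_norml => /andP[usp _].
have : B * `|p| <= B * (k * q).
  by rewrite ler_pM2l// (le_trans pk)// ler_pM2l.
by move: usn; rewrite ltr_norml => /andP[_]; rewrite /K; lra.
Unshelve. all: by end_near. Qed.

(** A cycle of inclusions: linearized, Frechet, limiting, linearized. *)
Lemma regular_normals (S : set Y) x : convex_set S -> S (f x) ->
  `|x - x0| < r ->
  frechet_normal (f @^-1` S) x = lin_normal f S x /\
  limiting_normal (f @^-1` S) x = lin_normal f S x.
Proof.
move=> cS Sx xr.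
have lf := lin_normal_frechet xr (S := S).
have fl : frechet_normal (f @^-1` S) x `<=` limiting_normal (f @^-1` S) x.
  exact: sub_limiting_normal.
have ll := limiting_normal_lin cS Sx xr.
split; apply/seteqP; split => //.
- exact: subset_trans fl ll.
- exact: subset_trans lf fl.
Qed.

(** Only competitors no farther from [x] than [x0] matter; the radius [r / 2] keeps them where [f]
    is Lipschitz. *)
Lemma dist_image_le (S : set Y) x : S (f x0) -> `|x - x0| < r / 2 ->
  dist (f x) S <= L * dist x (f @^-1` S).
Proof.
move=> S0 xr.
have L0 := reg_L_gt0 reg.
rewrite -ler_pdivrMl//; apply: le_dist; first by exists x0.
suff near_le y : S (f y) -> `|x - y| <= `|x - x0| ->
    L^-1 * dist (f x) S <= `|x - y|.
  move=> y Sy; have [yx|/ltW xy] := leP `|x - y| `|x - x0|; first exact: near_le.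
  by apply: le_trans xy; exact: near_le.
move=> Sy yx; rewrite ler_pdivrMl//; apply: le_trans (dist_le _ Sy) _.
apply: (reg_lip reg); first by have := normr_ge0 (x - x0); lra.
by have := ler_distD x y x0; rewrite (distrC y x); lra.
Qed.

(** The same reduction in [Y]: competitors no farther than [f x0] stay in the [s]-ball, where
    [reg_metric] lifts them. *)
Lemma dist_preimage_le (S : set Y) x : S (f x0) -> `|x - x0| < r ->
  `|f x - f x0| < s / 2 ->
  dist x (f @^-1` S) <= k * dist (f x) S.
Proof.
move=> S0 xr fxs.
have k0 := reg_k_gt0 reg.
rewrite -ler_pdivrMl//; apply: le_dist; first by exists (f x0).
suff near_le z : S z -> `|f x - z| <= `|f x - f x0| ->
    k^-1 * dist x (f @^-1` S) <= `|f x - z|.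
  move=> y Sy; have [yx|/ltW xy] := leP `|f x - y| `|f x - f x0|; first exact: near_le.
  by apply: le_trans xy; exact: near_le.
move=> Sz zx; rewrite ler_pdivrMl//.
have [|y fy yx] := reg_metric reg xr (z := z).
  by have := ler_distD (f x) z (f x0); rewrite (distrC z (f x)); lra.
by apply: le_trans yx; rewrite distrC; apply: dist_le; rewrite /preimage/= fy.
Qed.

End RegularNormals.

(** * Subtransversality *)

Lemma lt_minW {R : realType} (a b c : R) : a < Num.min b c -> a < b /\ a < c.
Proof. by rewrite lt_min => /andP. Qed.

Lemma ball_distE {R : realType} {V : normedModType R} (x y : V) (e : R) :
  ball x e y = (`|x - y| < e) :> Prop.
Proof. by rewrite -ball_normE. Qed.

Lemma convex_bigcap {R : numDomainType} {V : lmodType R} {I : Type}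
    (C : I -> set (convex_lmodType V)) :
  (forall i, convex_set (C i)) -> convex_set (\bigcap_i C i).
Proof.
move=> cC u v t /set_mem Cu /set_mem Cv; apply/mem_set => i _; apply/set_mem.
by apply: cC; apply/mem_set; [exact: Cu|exact: Cv].
Qed.

(* The strong CHIP and property (G) with constant [tau] for the linearized
   normal cones, merged into one inclusion. *)
Definition normal_bound {R : realType} {X Y : normedModType R} {m : nat}
    (f : X -> Y) (C : 'I_m -> set Y) (tau : R) (x : X) : Prop :=
  lin_normal f (\bigcap_i C i) x `&` dual_ball X `<=`
  [set tau *: s | s in
    minkowski_sum (fun i => lin_normal f (C i) x `&` dual_ball X)].

Section DualCones.
Context {R : realType} {X Y : normedModType R} {f : X -> Y}.
Implicit Types (S : set Y) (x : X) (l : X -> R^o).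

Lemma dual_scale (a : R) l : dual X l -> dual X (a *: l).
Proof.
move=> [linl cl]; split=> [b u v|x]; last first.
  by apply: cvgZr; exact: cl.
rewrite -![LHS]/(a *: _) linl scalerDr !scalerA mulrC.
by rewrite -scalerA.
Qed.

Lemma dual_sum m (ls : 'I_m -> X -> R^o) : (forall i, dual X (ls i)) ->
  dual X (\sum_(i < m) ls i).
Proof.
move=> dls; apply: (big_ind (dual X)) => //.
  split=> [b u v|x]; last exact: cvg_cst.
  by rewrite -![LHS]/(0 : R) -[_ u]/(0 : R) -[_ v]/(0 : R) scaler0 addr0.
move=> l1 l2 [linl1 cl1] [linl2 cl2]; split=> [b u v|x]; last first.
  by apply: cvgD; [exact: cl1|exact: cl2].
rewrite -[LHS]/(l1 _ + l2 _) linl1 linl2 addrACA -scalerDr.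
by [].
Qed.

Lemma lin_normal_scale S x (a : R) l : 0 <= a ->
  lin_normal f S x l -> lin_normal f S x (a *: l).
Proof.
move=> a0 [dl lS]; split; first exact: dual_scale.
by move=> h /lS lh; rewrite -[leLHS]/(a * l h) mulr_ge0_le0.
Qed.

Lemma lin_normal_sum m (C : 'I_m -> set Y) x :
  minkowski_sum (fun i => lin_normal f (C i) x) `<=`
  lin_normal f (\bigcap_i C i) x.
Proof.
move=> _ [ls lsC ->]; split.
  by apply: dual_sum => i; case: (lsC i).
move=> h Sh; rewrite fct_sumE; apply: sumr_le0 => i _.
by apply: (lsC i).2; exact: Sh.
Qed.

(** The unit-ball inclusion already yields the CHIP, since any normal can be scaled into the dual
    ball and the cones absorb the scaling back. *)
Lemma normal_boundP m (C : 'I_m -> set Y) (tau : R) x : 0 < tau ->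
  (lin_normal f (\bigcap_i C i) x `<=`
     minkowski_sum (fun i => lin_normal f (C i) x) /\
   property_G tau (fun i => lin_normal f (C i) x)) <->
  normal_bound f C tau x.
Proof.
move=> tau0; split=> [[chip G] l [/chip Nl Bl]|nb]; first exact: G.
split=> [l Nl|l [/lin_normal_sum Nl Bl]]; last exact: nb.
have [[linl /(linear_continuousP linl)[c c0 lc]] _] := Nl.
have [|_ [ls lsP ->] lE] := nb (c^-1 *: l).
  split; first by apply: lin_normal_scale => //; rewrite invr_ge0 ltW.
  apply/dual_ballP; split.
    by have [] := dual_scale c^-1 Nl.1.
  move=> h; rewrite -[(c^-1 *: l) h]/(c^-1 * l h) normrM gtr0_norm ?invr_gt0//.
  by rewrite ler_pdivrMl.
exists (fun i => (c * tau) *: ls i).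
  by move=> i; apply: lin_normal_scale; [rewrite mulr_ge0// ltW|exact: (lsP i).1].
by rewrite -scaler_sumr -scalerA lE scalerA mulfV ?gt_eqF// scale1r.
Qed.

End DualCones.

Section Subtransversality.
Context {R : realType} {X Y : completeNormedModType R} {f : X -> Y} {x0 : X}
  {k L r s : R} (reg : regular_near f x0 k L r s) {m : nat} (C : 'I_m -> set Y)
  (C_convex : forall i, convex_set (C i)) (Cx0 : (\bigcap_i C i) (f x0)).

Let reg_gt0 : [/\ 0 < k, 0 < L, 0 < r & 0 < s].
Proof.
split; [exact: reg_k_gt0 reg|exact: reg_L_gt0 reg|exact: reg_r_gt0 reg|].
(* At [x0] itself [reg_image] reads [0 < s]. *)
have := reg_image reg (x := x0); rewrite !subrr !normr0; apply.
exact: reg_r_gt0 reg.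
Qed.

(** Distances to a set and to its preimage are comparable by [dist_image_le] and [dist_preimage_le];
    each direction uses both, multiplying the constant by [k * L]. *)
Lemma subtransversal_preimage :
  subtransversal (fun i => f @^-1` C i) x0 <-> subtransversal C (f x0).
Proof.
have [k0 L0 r0 s0] := reg_gt0.
rewrite /subtransversal -preimage_bigcap; split.
  move=> [tau [q [tau0 q0 tauP]]].
  pose d := Num.min (s / 2) (Num.min q (r / 2) / k).
  have d0 : 0 < d by rewrite /d lt_min !divr_gt0 ?lt_min ?q0 ?divr_gt0.
  exists (L * tau * k), d; split=> //; first by rewrite !mulr_gt0.
  move=> z; rewrite ball_distE => /lt_minW[zs].
  rewrite (ltr_pdivlMr _ _ k0) => /lt_minW[zq zr].
  have x0r : `|x0 - x0| < r by rewrite subrr normr0.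
  have [|y fy yx] := reg_metric reg x0r (z := z).
    by rewrite distrC; lra.
  have yq : `|y - x0| < q by apply: le_lt_trans yx _; rewrite mulrC.
  have yr : `|y - x0| < r / 2 by apply: le_lt_trans yx _; rewrite mulrC.
  have := dist_image_le reg Cx0 yr; rewrite fy => /le_trans; apply.
  rewrite -mulrA -mulrA ler_pM2l//.
  have yq' : ball x0 q y by rewrite ball_distE distrC.
  apply: le_trans (tauP y yq') _; rewrite ler_pM2l// mulr_sumr.
  apply: ler_sum => i _; rewrite -fy; apply: (dist_preimage_le reg) => //.
  - exact: Cx0.
  - by lra.
  - by rewrite fy distrC.
move=> [tau [q [tau0 q0 tauP]]].
pose d := Num.min (r / 2) (Num.min q (s / 2) / L).
have d0 : 0 < d by rewrite /d lt_min !divr_gt0 ?lt_min ?q0 ?divr_gt0.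
exists (k * tau * L), d; split=> //; first by rewrite !mulr_gt0.
move=> y; rewrite ball_distE distrC => /lt_minW[yr].
rewrite (ltr_pdivlMr _ _ L0) => /lt_minW[yq ys].
have yr' : `|y - x0| < r by lra.
have x0r : `|x0 - x0| < r by rewrite subrr normr0.
have := reg_lip reg yr' x0r; rewrite mulrC => fyx.
apply: le_trans (dist_preimage_le reg Cx0 yr' (le_lt_trans fyx ys)) _.
rewrite -mulrA -mulrA ler_pM2l//.
have yq' : ball (f x0) q (f y).
  by rewrite ball_distE distrC (le_lt_trans fyx).
apply: le_trans (tauP _ yq') _; rewrite ler_pM2l// mulr_sumr.
by apply: ler_sum => i _; apply: (dist_image_le reg) => //; exact: Cx0.
Qed.

(* Openness of ['d f x] corrects [h] into the linearized set at a cost proportional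
   to a distance in [Y]. *)
Lemma lin_normal_le_dist (S : set Y) x l h : S !=set0 -> `|x - x0| < r ->
  lin_normal f S x l -> (forall h, `|l h| <= `|h|) ->
  l h <= k * dist (f x + 'd f x h) S.
Proof.
have [k0 L0 r0 s0] := reg_gt0.
move=> S0 xr [[linl _] lS] l1; rewrite -ler_pdivrMl//; apply: le_dist => // c Sc.
have [p pE pk] := reg_open reg (c - (f x + 'd f x h)) xr.
rewrite ler_pdivrMl// distrC; apply: le_trans pk.
have : l (h + p) <= 0.
  apply: lS; rewrite (linear_funD (linear_diff f x)) pE addrA.
  by rewrite addrC subrK.
rewrite (linear_funD linl); have := l1 p; rewrite ler_norml => /andP[lp _].
by lra.
Qed.

Lemma subtransversal_normal_bound : subtransversal C (f x0) ->
  exists tau d : R, [/\ 0 < tau, 0 < d & forall x, (\bigcap_i C i) (f x) ->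
    `|x - x0| < d -> normal_bound f C tau x].
Proof.
have [k0 L0 r0 s0] := reg_gt0.
move=> [tau [q [tau0 q0 tauP]]].
pose d := Num.min r (q / 2 / L).
have d0 : 0 < d by rewrite /d lt_min r0 !divr_gt0.
pose M := k * tau * L.
have M0 : 0 < M by rewrite !mulr_gt0.
have kt0 : 0 < k * tau by rewrite mulr_gt0.
exists M, d; split=> // x Cx /lt_minW[xr].
rewrite ltr_pdivlMr// mulrC => xq l [Nl /dual_ballP[linl l1]].
have lind := linear_diff f x.
pose p i h := k * tau * dist (f x + 'd f x h) (C i).
have Cne i : C i !=set0 by exists (f x); exact: Cx.
have affine (u v : X) (t : R) : f x + 'd f x (t *: u + (1 - t) *: v) =
    t *: (f x + 'd f x u) + (1 - t) *: (f x + 'd f x v).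
  rewrite (linear_funD lind) !(linear_funZ lind) !scalerDr addrACA -scalerDl.
  by rewrite [t + _]addrC subrK scale1r.
have cp i : convexf (p i).
  move=> u v t t01; rewrite /p affine.
  have := convexf_dist (Cne i) (@C_convex i) (f x + 'd f x u) (f x + 'd f x v) t01.
  by rewrite -(ler_pM2l kt0); lra.
have p0 i : p i 0 = 0.
  by rewrite /p (linear_fun0 lind) addr0 dist_mem ?mulr0//; exact: Cx.
have bp i u h : p i h - k * tau * `|'d f x u| <= p i (u + h).
  rewrite lerBlDr /p -mulrDr ler_pM2l//.
  apply: le_trans (dist_lipschitz _ (f x + 'd f x (u + h)) (Cne i)) _.
  rewrite lerD2l (linear_funD lind) opprD addrACA subrr add0r opprD addrCA.
  by rewrite subrr addr0 normrN.
have lp_near h : `|'d f x h| < q / 2 -> l h <= \sum_(i < m) p i h.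
  move=> hq; have S0 : (\bigcap_i C i) !=set0 by exists (f x).
  apply: le_trans (lin_normal_le_dist h S0 xr Nl l1) _.
  rewrite /p -mulr_sumr -mulrA ler_pM2l//; apply: tauP.
  rewrite ball_distE.
  have x0r : `|x0 - x0| < r by rewrite subrr normr0.
  have := reg_lip reg xr x0r; have := ler_normD (f x0 - f x) (- 'd f x h).
  by rewrite normrN opprD addrA (distrC (f x0)); lra.
have lp h : l h <= \sum_(i < m) p i h.
  (* A factor in []0, 1]] bringing the derivative of [f] along [t *: h] below [q / 2]; convexity and
     [p i 0 = 0] then carry the inequality back to [h]. *)
  pose t := q / (q + 2 * (L * `|h|)).
  have Lh : 0 <= L * `|h| by rewrite mulr_ge0// ltW.
  have qh : 0 < q + 2 * (L * `|h|) by lra.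
  have t0 : 0 < t by rewrite divr_gt0.
  have t1 : t <= 1 by rewrite ler_pdivrMr// mul1r; lra.
  have : l (t *: h) <= \sum_(i < m) p i (t *: h).
    apply: lp_near; rewrite (linear_funZ lind) normrZ gtr0_norm//.
    apply: le_lt_trans (_ : t * (L * `|h|) < _).
      by rewrite ler_pM2l//; exact: (reg_dlip reg).
    by rewrite /t mulrAC ltr_pdivrMr//; have := mulr_gt0 q0 q0; lra.
  have := @convexf_scale _ _ (fun h => \sum_(i < m) p i h) h t (convexf_sum cp).
  rewrite (ltW t0) t1 big1// => /(_ erefl isT) pt.
  by move=> /le_trans /(_ pt); rewrite (linear_funZ linl) ler_pM2l.
have [ls lsP lE] := linear_le_sum_split cp p0 bp linl lp.
(* [p i] grows at rate at most [k * tau * L], so dividing the pieces by [M] puts them in the dual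
   ball; they are normals because [p i] vanishes on the linearized set. *)
have lsM i h : `|ls i h| <= M * `|h|.
  have H u : ls i u <= M * `|u|.
    apply: le_trans ((lsP i).2 u) _; rewrite /p /M -[leRHS]mulrA ler_pM2l//.
    apply: le_trans (reg_dlip reg u xr); apply: le_trans (dist_le _ (Cx i I)) _.
    by rewrite addrAC subrr add0r.
  rewrite ler_norml H andbT lerNl -(linear_funN (lsP i).1) -(normrN h); exact: H.
have dls i : dual X (ls i).
  split; first exact: (lsP i).1.
  by apply/(linear_continuousP (lsP i).1); exists M.
exists (M^-1 *: l); last by rewrite scalerA mulfV ?gt_eqF// scale1r.
exists (fun i => M^-1 *: ls i); last by rewrite -scaler_sumr -lE.
move=> i; split.
  apply: lin_normal_scale; first by rewrite invr_ge0 ltW.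
  split=> // h Ch; apply: le_trans ((lsP i).2 h) _.
  by rewrite /p dist_mem ?mulr0.
apply/dual_ballP; split; first exact: (dual_scale _ (dls i)).1.
move=> h; rewrite -[(_ *: _) h]/(M^-1 * ls i h) normrM gtr0_norm ?invr_gt0//.
by rewrite ler_pdivrMl.
Qed.

Lemma normal_bound_subtransversal (tau d : R) :
  (forall i, closed (C i)) -> 0 < tau -> 0 < d ->
  (forall x, (\bigcap_i C i) (f x) -> `|x - x0| < d ->
    normal_bound f C tau x) ->
  subtransversal C (f x0).
Proof.
have [k0 L0 r0 s0] := reg_gt0.
move=> C_closed tau0 d0 nb.
pose S := \bigcap_i C i.
have S_closed : closed S by apply: closed_bigI => i _; exact: C_closed.
have S_convex := convex_bigcap C_convex.
(* This keeps [c], at most twice as far from [f x0] as [z], in the [s]-ball, and its lift [x] within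
   [d] and [r] of [x0]. *)
pose q := Num.min (s / 2) (Num.min d r / (2 * k)).
have k20 : 0 < 2 * k by rewrite mulr_gt0.
have q0 : 0 < q by rewrite /q lt_min !divr_gt0 ?lt_min ?d0.
exists (4 * L * tau * k), q; split=> //; first by rewrite !mulr_gt0.
move=> z; rewrite ball_distE distrC => /lt_minW[zs].
rewrite (ltr_pdivlMr _ _ k20) => /lt_minW[zd zr].
have [c [l [Sc cz linl [l2 lS lc]]]] := approx_projection_normal z S_closed S_convex Cx0.
have cx0 : `|c - f x0| <= 2 * `|z - f x0|.
  by have := ler_distD z c (f x0); rewrite (distrC c z); lra.
have x0r : `|x0 - x0| < r by rewrite subrr normr0.
have [|x fx xk] := reg_metric reg x0r (z := c); first by lra.
have xz : `|x - x0| <= `|z - f x0| * (2 * k).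
  apply: le_trans xk _; rewrite distrC.
  by rewrite mulrA -[leRHS]mulrC ler_pM2l// mulrC.
have lind := linear_diff f x.
have xd := le_lt_trans xz zd; have xr := le_lt_trans xz zr.
(* The pullback of [l] has norm at most [2 * L]; this factor and the 2 in [lc] make up the [4 * L]
   of the final constant. *)
pose xs : X -> R^o := (2 * L)^-1 *: (fun h => l ('d f x h) : R^o).
have L20 : 0 < 2 * L by rewrite mulr_gt0.
have linxs0 : linear (fun h => l ('d f x h) : R^o).
  by move=> a u v; rewrite lind linl.
have xs0 h : `|l ('d f x h)| <= 2 * L * `|h|.
  by apply: le_trans (l2 _) _; rewrite -mulrA ler_pM2l//; exact: (reg_dlip reg).
have Nxs : lin_normal f S x xs.
  apply: lin_normal_scale; first by rewrite invr_ge0 ltW.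
  split.
    by split=> //; apply/(linear_continuousP linxs0); exists (2 * L).
  by move=> h /lS; rewrite fx [c + _]addrC addrK.
have xs1 : dual_ball X xs.
  apply/dual_ballP; split; first exact: Nxs.1.1.
  move=> h; rewrite -[xs h]/((2 * L)^-1 * l ('d f x h)) normrM.
  by rewrite gtr0_norm ?invr_gt0// ler_pdivrMl.
have Sx : S (f x) by rewrite fx.
have [_ [ls lsP ->] lsE] := nb x Sx xd xs (conj Nxs xs1).
(* With this [h], [z] is the value at [h] of the linearization at [x], so each piece at [h] is
   bounded by [k] times the distance from [z] to [C i]. *)
have [h hE _] := reg_open reg (z - c) xr.
have xsh : xs h = tau * \sum_(i < m) ls i h.
  by rewrite -lsE -[LHS]/(tau * (\sum_(i < m) ls i) h) fct_sumE.
apply: le_trans (dist_le _ Sc) _; apply: le_trans lc _.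
have -> : l (z - c) = 2 * L * xs h.
  by rewrite -hE -[xs h]/((2 * L)^-1 * l ('d f x h)) mulVKf// gt_eqF.
have : \sum_(i < m) ls i h <= k * \sum_(i < m) dist z (C i).
  rewrite mulr_sumr; apply: ler_sum => i _.
  have [Ni /dual_ballP[_ l1]] := lsP i.
  have -> : z = f x + 'd f x h by rewrite fx hE addrC subrK.
  by apply: lin_normal_le_dist => //; exists (f x0); exact: Cx0.
have Lt : 0 < 4 * L * tau by rewrite !mulr_gt0.
by rewrite -(ler_pM2l Lt) xsh; lra.
Qed.

(** The cone [N] is abstract so that one argument serves Frechet and limiting normals; radii are
    shrunk to [r], where [N] is the linearized cone. *)
Lemma normal_cones_normal_bound (N : set X -> X -> set (X -> R^o)) :
  (forall S x, convex_set S -> S (f x) -> `|x - x0| < r ->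
     N (f @^-1` S) x = lin_normal f S x) ->
  (exists tau d : R, [/\ 0 < tau, 0 < d & forall x,
     (\bigcap_i f @^-1` C i) x -> ball x0 d x ->
     N (\bigcap_i f @^-1` C i) x `<=`
       minkowski_sum (fun i => N (f @^-1` C i) x) /\
     property_G tau (fun i => N (f @^-1` C i) x)]) <->
  (exists tau d : R, [/\ 0 < tau, 0 < d & forall x, (\bigcap_i C i) (f x) ->
     `|x - x0| < d -> normal_bound f C tau x]).
Proof.
move=> NE; have [k0 L0 r0 s0] := reg_gt0.
have NiE x : (\bigcap_i C i) (f x) -> `|x - x0| < r ->
    (fun i => N (f @^-1` C i) x) = (fun i => lin_normal f (C i) x).
  move=> Cx xr; apply/funext => i; apply: NE => //; exact: Cx.
have NIE x : (\bigcap_i C i) (f x) -> `|x - x0| < r ->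
    N (\bigcap_i f @^-1` C i) x = lin_normal f (\bigcap_i C i) x.
  move=> Cx xr; rewrite -preimage_bigcap; apply: NE => //.
  exact: convex_bigcap.
split=> -[tau [d [tau0 d0 H]]].
  exists tau, (Num.min d r); split=> //; first by rewrite lt_min d0.
  move=> x Cx /lt_minW[xd xr]; apply/normal_boundP => //.
  rewrite -(NIE x Cx xr) -(NiE x Cx xr); apply: H => //.
  by rewrite ball_distE distrC.
exists tau, (Num.min d r); split=> //; first by rewrite lt_min d0.
move=> x Cx; rewrite ball_distE distrC => /lt_minW[xd xr].
by rewrite (NIE x Cx xr) (NiE x Cx xr); apply/normal_boundP => //; exact: H.
Qed.

End Subtransversality.

Theorem theorem3p4 (R : realType) (X Y : completeNormedModType R)
  (asplundX : asplund X) (asplundY : asplund Y)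
  (f : X -> Y) (f_C1 : continuously_differentiable f)
  (m : nat) (C : 'I_m -> set Y)
  (C_closed : forall i, closed (C i)) (C_convex : forall i, convex_set (C i))
  (C_nonempty : \bigcap_i C i !=set0)
  (xbar : X) :
  let A := fun i : 'I_m => f @^-1` C i in
  (\bigcap_i A i) xbar ->
  range ('d f xbar) = [set: Y] ->
  let stmt_i := subtransversal A xbar in
  let stmt_ii := exists tau delta : R, [/\ 0 < tau, 0 < delta &
    forall x, (\bigcap_i A i) x -> ball xbar delta x ->
      strong_frechet_CHIP A x /\
      property_G tau (fun i => frechet_normal (A i) x)] in
  let stmt_iii := exists tau delta : R, [/\ 0 < tau, 0 < delta &
    forall x, (\bigcap_i A i) x -> ball xbar delta x ->
      strong_limiting_CHIP A x /\
      property_G tau (fun i => limiting_normal (A i) x)] in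
  (stmt_i <-> stmt_ii) /\ (stmt_ii <-> stmt_iii).
Proof.
move=> A Ax surj stmt_i stmt_ii stmt_iii.
have [k [L [r [s reg]]]] := surjective_regular_near f_C1 surj.
have Cx : (\bigcap_i C i) (f xbar) := Ax.
have subE : stmt_i <-> exists tau d : R, [/\ 0 < tau, 0 < d & forall x,
    (\bigcap_i C i) (f x) -> `|x - xbar| < d -> normal_bound f C tau x].
  rewrite /stmt_i (subtransversal_preimage reg Cx); split.
    exact (subtransversal_normal_bound reg C_convex).
  move=> [tau [d [tau0 d0 nb]]].
  exact (normal_bound_subtransversal reg C_convex Cx C_closed tau0 d0 nb).
have frechetE := normal_cones_normal_bound reg C_convex (N := frechet_normal)
  (fun S x cS Sx xr => (regular_normals f_C1 reg cS Sx xr).1).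
have limitingE := normal_cones_normal_bound reg C_convex (N := limiting_normal)
  (fun S x cS Sx xr => (regular_normals f_C1 reg cS Sx xr).2).
split; first exact: iff_trans subE (iff_sym frechetE).
exact: iff_trans frechetE (iff_sym limitingE).
Qed.
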